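(* There is a polynomial time algorithm which, given a third almost-regular hypergraph degree sequence $$D=(d_{1,1},\ldots,d_{1,n_1}),\ (d_{2,1},\ldots,d_{2,n_2}),\ (d_{3,1},\ldots,d_{3,n_3}),$$ decides whether $D$ is graphic and, if $D$ is graphic, also constructs a realization of $D$.
   Context: A partite $3$-uniform hypergraph (below: hypergraph) $H=(A,B,C,E)$ has a finite vertex set that is the disjoint union of three vertex classes $A,B,C$, and a set $E$ of hyperedges, each containing exactly one vertex of each class; thus $E$ can be identified with a subset of $A\times B\times C$. The degree of a vertex is the number of hyperedges containing it. A hypergraph degree sequence $D$ consists of three finite sequences of non-negative integers $(d_{i,1},\ldots,d_{i,n_i})$, $i=1,2,3$. A hypergraph with classes of sizes $n_1,n_2,n_3$ is a realization of $D$ if, for all $i$ and $j$, the $j$-th vertex of the $i$-th class has degree $d_{i,j}$; $D$ is graphic if it has a realization. $D$ is third almost-regular if for some integer $k$, $d_{1,i}\in\{k,k-1\}$ for all $i=1,\ldots,n_1$ (there is no restriction on the degrees in the other two classes). *)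

(* Defs.v *)
From mathcomp Require Import all_boot all_order all_algebra.

Set Implicit Arguments.
Unset Strict Implicit.
Unset Printing Implicit Defensive.

Definition hypergraph (A B C : finType) := {set A * B * C}.

Definition degree1 (A B C : finType) (H : hypergraph A B C) (a : A) : nat :=
  #|[set e in H | e.1.1 == a]|.
Definition degree2 (A B C : finType) (H : hypergraph A B C) (b : B) : nat :=
  #|[set e in H | e.1.2 == b]|.
Definition degree3 (A B C : finType) (H : hypergraph A B C) (c : C) : nat :=
  #|[set e in H | e.2 == c]|.

Record degree_sequence :=
  DegreeSequence { deg1 : seq nat; deg2 : seq nat; deg3 : seq nat }.

(* Vertices are numbered from 0: the i-th class is 'I_(n_i), where n_i is the
   length of the i-th sequence. *)
Definition hypergraph_on (D : degree_sequence) :=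
  hypergraph 'I_(size (deg1 D)) 'I_(size (deg2 D)) 'I_(size (deg3 D)).

Definition realization (D : degree_sequence) (H : hypergraph_on D) : bool :=
  [&& [forall j, degree1 H j == nth 0 (deg1 D) j],
      [forall j, degree2 H j == nth 0 (deg2 D) j]
    & [forall j, degree3 H j == nth 0 (deg3 D) j]].

Definition graphic (D : degree_sequence) : bool :=
  [exists H : hypergraph_on D, realization H].

Definition third_almost_regular (D : degree_sequence) : Prop :=
  exists k : int, forall d : nat, d \in deg1 D ->
    d%:Z%R = k \/ d%:Z%R = (k - 1)%R.

(* The model of Cook and Reckhow (Time bounded random access machines, 1973),
   with natural-number registers and truncated subtraction. There is no
   multiplication, and every operation is charged the bit length of the
   numbers it handles, indirect addresses included, so that polynomial time
   on this machine is polynomial time on a multitape Turing machine. *)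
Inductive instr :=
| Const of nat & nat        (* Const i n    X_i := n *)
| Add of nat & nat & nat    (* Add i j k    X_i := X_j + X_k *)
| Sub of nat & nat & nat    (* Sub i j k    X_i := X_j - X_k, truncated at 0 *)
| Fetch of nat & nat        (* Fetch i j    X_i := X_(X_j) *)
| Store of nat & nat        (* Store i j    X_(X_i) := X_j *)
| Jump of nat & nat         (* Jump j m     go to instruction m if X_j > 0 *)
| Read of nat               (* Read i       X_i := next input number *)
| Print of nat.             (* Print i      output X_i *)

Definition program := seq instr.

Record state := State {
  pc : nat;
  reg : nat -> nat;
  inp : seq nat;    (* the unread part of the input *)
  out : seq nat     (* the numbers printed so far, in order *)
}.

Definition upd (r : nat -> nat) (i v : nat) : nat -> nat :=
  fun j => if j == i then v else r j.

(* Reading past the end of the input yields 0. *)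
Definition step (c : instr) (s : state) : state :=
  let: State l r x y := s in
  match c with
  | Const i n => State l.+1 (upd r i n) x y
  | Add i j k => State l.+1 (upd r i (r j + r k)) x y
  | Sub i j k => State l.+1 (upd r i (r j - r k)) x y
  | Fetch i j => State l.+1 (upd r i (r (r j))) x y
  | Store i j => State l.+1 (upd r (r i) (r j)) x y
  | Jump j m => State (if 0 < r j then m else l.+1) r x y
  | Read i => State l.+1 (upd r i (head 0 x)) (behead x) y
  | Print i => State l.+1 r x (rcons y (r i))
  end.

(* The length of n in binary; 0 has length 1. *)
Definition bitlen (n : nat) : nat := (trunc_log 2 n).+1.

Definition cost (c : instr) (s : state) : nat :=
  let: State _ r x _ := s in
  match c with
  | Const _ n => bitlen n
  | Add _ j k => bitlen (r j) + bitlen (r k)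
  | Sub _ j k => bitlen (r j) + bitlen (r k)
  | Fetch _ j => bitlen (r j) + bitlen (r (r j))
  | Store i j => bitlen (r i) + bitlen (r j)
  | Jump j _ => bitlen (r j)
  | Read _ => bitlen (head 0 x)
  | Print i => bitlen (r i)
  end.

(* [exec P s t s']: started in s, the program P halts in s' at total cost t.
   The machine halts when its program counter leaves the program. *)
Inductive exec (P : program) : state -> nat -> state -> Prop :=
| exec_halt s : size P <= pc s -> exec P s 0 s
| exec_step s t s' c :
    onth P (pc s) = Some c ->
    exec P (step c s) t s' ->
    exec P s (cost c s + t) s'.

Definition computes_in_time (P : program) (x : seq nat) (t : nat) (y : seq nat)
    : Prop :=
  exists2 s : state, exec P (State 0 (fun=> 0) x [::]) t s & out s = y.

Definition bitsize (x : seq nat) : nat := \sum_(n <- x) bitlen n.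

Definition encode (D : degree_sequence) : seq nat :=
  [:: size (deg1 D); size (deg2 D); size (deg3 D)]
    ++ deg1 D ++ deg2 D ++ deg3 D.

(* The answer 0 rejects D; the answer 1 accepts it and is followed by the
   hyperedges of a realization, each listed exactly once. *)
Definition correct_answer (D : degree_sequence) (y : seq nat) : Prop :=
  if graphic D then
    exists es : seq ('I_(size (deg1 D)) * 'I_(size (deg2 D))
                                        * 'I_(size (deg3 D))),
      [/\ uniq es,
          realization (D := D) [set e in es]
        & y = 1 :: flatten [seq [:: val e.1.1; val e.1.2; val e.2] | e <- es]]
  else y = [:: 0].

(* Main.v *)
Require Import Defs.
From mathcomp Require Import all_boot all_order all_algebra.
From mathcomp Require Import zify.

(* Let W(b, c) be the number of hyperedges through b and c. An almost-regular
   first class can always be spread evenly over the pairs (b, c), so D is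
   graphic iff its three sums agree and there is a matrix W with entries at most
   n_1, row sums d_2 and column sums d_3. Such a W is found greedily, row by row:
   each unit of the current row goes to a column whose remaining degree is
   maximal among those where the row has not reached n_1 yet; an exchange
   argument shows that this never destroys a completion. Then each unit of
   W(b, c) goes to a vertex of the first class whose remaining degree is maximal
   among those not yet joined to (b, c); the remaining degrees never differ by
   more than one, so this cannot get stuck. Both phases are written in a loop
   language whose programs are compiled to the machine; the number of machine
   steps is polynomial, and n steps add at most n bits to any register, so the
   cost is polynomial too. *)

Set Implicit Arguments.
Unset Strict Implicit.
Unset Printing Implicit Defensive.

(** * Binary lengths *)

Lemma bitlen_leq n L : 0 < L -> n < 2 ^ L -> bitlen n <= L.
Proof.
rewrite /bitlen => L_gt0 n_lt; case: (posnP n) => [-> | n_gt0].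
  by rewrite trunc_log0.
by rewrite -(ltn_exp2l _ _ (ltnSn 1)) (leq_ltn_trans _ n_lt) // trunc_logP.
Qed.

Lemma ltn_bitlen n : n < 2 ^ bitlen n.
Proof. exact: trunc_log_ltn. Qed.

(** * Step counts bound costs *)

(** Runs are counted in steps here and, unlike those of [exec], may stop anywhere, so the runs of
    consecutive pieces of code can be composed. *)
Inductive reach (P : program) : nat -> state -> state -> Prop :=
| reach0 s : reach P 0 s s
| reachS n c s1 s2 s3 :
    onth P (pc s1) = Some c -> s2 = step c s1 -> reach P n s2 s3 ->
    reach P n.+1 s1 s3.

Lemma reach_trans P m n s1 s2 s3 :
  reach P m s1 s2 -> reach P n s2 s3 -> reach P (m + n) s1 s3.
Proof.
elim=> [s | {}m c s s' s'' sP ss' _ IH] s3P; first by rewrite add0n.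
by rewrite addSn; apply: reachS sP ss' (IH s3P).
Qed.

Definition instr_const (c : instr) := if c is Const _ n then n else 0.

Definition bounded (L : nat) (s : state) :=
  (forall i, reg s i < 2 ^ L) /\ (forall n, n \in inp s -> n < 2 ^ L).

(** An addition at most doubles the largest number, which is one more bit; every other instruction
    copies, decreases or loads a number below [2 ^ L]. No instruction is charged for more than two
    numbers. *)
Lemma step_bounded c s L : 0 < L ->
  instr_const c < 2 ^ L -> bounded L s ->
  cost c s <= 2 * L /\ bounded L.+1 (step c s).
Proof.
case: s => l r x y L_gt0 cL [/= rL xL].
have bL n : n < 2 ^ L -> bitlen n <= L by apply: bitlen_leq.
have hL : head 0 x < 2 ^ L.
  by case: x xL => [|n x] xL /=; rewrite ?expn_gt0 // xL // mem_head.
have expS : 2 ^ L.+1 = 2 ^ L + 2 ^ L by rewrite expnS mul2n addnn.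
have sL n : n < 2 ^ L -> n < 2 ^ L.+1 by rewrite expS; lia.
have uL i v : v < 2 ^ L.+1 -> forall j, upd r i v j < 2 ^ L.+1.
  by move=> vL j; rewrite /upd; case: eqP => // _; apply: sL.
split.
  case: c cL => [i n|i j k|i j k|i j|i j|j m|i|i] /= cL; rewrite mul2n -addnn;
    by [apply: leq_add; apply: bL | apply: leq_trans (leq_addr _ _); apply: bL].
case: c cL => [i n|i j k|i j k|i j|i j|j m|i|i] /= cL; split=> //=;
  try by move=> n' n'x; apply/sL/xL.
- exact/uL/sL.
- by apply: uL; rewrite expS; have := rL j; have := rL k; lia.
- by apply: uL; have /sL := rL j; lia.
- exact/uL/sL.
- exact/uL/sL.
- by move=> j'; apply: sL.
- exact/uL/sL.
- by move=> n' /mem_behead n'x; apply/sL/xL.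
- by move=> j'; apply: sL.
Qed.

(** During [n] steps no number outgrows [L + n] bits, so each step costs at most twice that. *)
Lemma exec_of_reach P n s s' L : 0 < L ->
  (forall i c, onth P i = Some c -> instr_const c < 2 ^ L) -> bounded L s ->
  reach P n s s' -> size P <= pc s' ->
  exists2 t, exec P s t s' & t <= n * (2 * (L + n)).
Proof.
move=> L_gt0 PL sL ss'; elim: ss' L L_gt0 PL sL => {n s s'}
  [s | n c s1 s2 s3 s1P -> _ IH] L L_gt0 PL sL halt.
  by exists 0; [apply: exec_halt |].
have [costL s2L] := step_bounded L_gt0 (PL _ c s1P) sL.
have {}PL i c' : onth P i = Some c' -> instr_const c' < 2 ^ L.+1.
  by move=> /PL /leq_trans -> //; rewrite leq_exp2l.
have [t exec_t t_le] := IH L.+1 isT PL s2L halt.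
exists (cost c s1 + t); first exact: exec_step s1P exec_t.
by rewrite mulSn leq_add //; [lia | rewrite addnS -addSn].
Qed.

(** * A loop language and its compiler *)

(* Row 0 of the memory holds the scalar variables, rows 1 to 6 hold arrays. *)
Definition memory := nat -> nat -> nat.

Record config := Config { mem : memory; unread : seq nat; printed : seq nat }.

Inductive cmd :=
| CSkip
| CSet of nat & nat
| CAdd of nat & nat & nat
| CSub of nat & nat & nat
| CLoad of nat & nat & nat
| CSave of nat & nat & nat
| CRead of nat
| CPrint of nat
| CSeq of cmd & cmd
| CIf of nat & cmd & cmd
| CFor of nat & nat & cmd.

Local Notation "c1 ;; c2" := (CSeq c1 c2) (at level 60, right associativity).

Definition updm (m : memory) (a i v : nat) : memory :=
  fun a' i' => if (a' == a) && (i' == i) then v else m a' i'.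

Definition setv (s : config) (x v : nat) :=
  Config (updm (mem s) 0 x v) (unread s) (printed s).

Local Notation var s := (mem s 0).

Fixpoint eval (c : cmd) (s : config) : config :=
  match c with
  | CSkip => s
  | CSet x n => setv s x n
  | CAdd x y z => setv s x (var s y + var s z)
  | CSub x y z => setv s x (var s y - var s z)
  | CLoad x a i => setv s x (mem s a (var s i))
  | CSave a i x =>
      Config (updm (mem s) a (var s i) (var s x)) (unread s) (printed s)
  | CRead x => Config (updm (mem s) 0 x (head 0 (unread s)))
                      (behead (unread s)) (printed s)
  | CPrint x => Config (mem s) (unread s) (rcons (printed s) (var s x))
  | CSeq c1 c2 => eval c2 (eval c1 s)
  | CIf x c1 c2 => if 0 < var s x then eval c1 s else eval c2 s
  | CFor x y c =>
      iter (var s y) (fun s' => let s'' := eval c s' in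
                                setv s'' x (var s'' x).+1) (setv s x 0)
  end.

Lemma eval_seq c1 c2 s : eval (c1 ;; c2) s = eval c2 (eval c1 s).
Proof. by []. Qed.

Lemma eval_if x c1 c2 s :
  eval (CIf x c1 c2) s = if 0 < var s x then eval c1 s else eval c2 s.
Proof. by []. Qed.

Fixpoint assigned (c : cmd) : seq nat :=
  match c with
  | CSet x _ | CAdd x _ _ | CSub x _ _ | CLoad x _ _ | CRead x => [:: x]
  | CSkip | CSave _ _ _ | CPrint _ => [::]
  | CSeq c1 c2 | CIf _ c1 c2 => assigned c1 ++ assigned c2
  | CFor x _ c => x :: assigned c
  end.

Fixpoint saved (c : cmd) : seq nat :=
  match c with
  | CSave a _ _ => [:: a]
  | CSeq c1 c2 | CIf _ c1 c2 => saved c1 ++ saved c2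
  | CFor _ _ c => saved c
  | _ => [::]
  end.

(* Variables 0, 1 and 2 are read-only and are the only loop bounds; this makes
   every loop length a constant of the run. *)
Fixpoint wf (c : cmd) : bool :=
  match c with
  | CSet x _ | CAdd x _ _ | CSub x _ _ | CRead x => 2 < x
  | CSkip | CPrint _ => true
  | CLoad x a _ => (2 < x) && (a < 7)
  | CSave a _ _ => 0 < a < 7
  | CSeq c1 c2 | CIf _ c1 c2 => wf c1 && wf c2
  | CFor x y c => [&& 2 < x, y <= 2, x \notin assigned c & wf c]
  end.

Definition frame c s s' := forall a i,
  (if a == 0 then i \notin assigned c else a \notin saved c) ->
  mem s' a i = mem s a i.

(** Well-formedness matters at [CSave]: a save into row 0 would change a scalar that [assigned] does
    not list. *)
Lemma eval_frame c s : wf c -> frame c s (eval c s).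
Proof.
have updE m x v a' i' : (if a' == 0 then i' \notin [:: x] else true) ->
    updm m 0 x v a' i' = m a' i'.
  by rewrite /updm; case: (a' == 0) => //=; rewrite inE => /negPf ->.
move=> + a i; elim: c s => //=.
- by move=> x n s _ fr; apply: updE; case: (a == 0) fr.
- by move=> x n n' s _ fr; apply: updE; case: (a == 0) fr.
- by move=> x n n' s _ fr; apply: updE; case: (a == 0) fr.
- by move=> x n n' s _ fr; apply: updE; case: (a == 0) fr.
- move=> a' j x s /andP[a'_gt0 _] fr; rewrite /updm.
  case: (eqVneq a a') fr => //= ->.
  by rewrite inE eqxx eqn0Ngt a'_gt0.
- by move=> x s _ fr; apply: updE; case: (a == 0) fr.
- move=> c1 IH1 c2 IH2 s /andP[wf1 wf2] fr.
  by rewrite IH2 ?IH1 //; case: (a == 0) fr; rewrite mem_cat => /norP[].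
- move=> x c1 IH1 c2 IH2 s /andP[wf1 wf2] fr.
  by case: ifP => _; rewrite ?IH2 ?IH1 //; case: (a == 0) fr; rewrite mem_cat => /norP[].
- move=> x y c IH s /and4P[_ _ _ wfc] fr.
  elim: (var s y) => [|n IHn] /=; rewrite updE ?IH //;
    by case: (a == 0) fr; rewrite // !inE => /norP[].
Qed.

Lemma frame_For x y c s s' s'' :
  frame (CFor x y c) s s' -> frame c s' s'' -> frame (CFor x y c) s s''.
Proof.
move=> fr fr' a i ai; rewrite fr' ?fr //; move: ai => /=.
by case: (a == 0); rewrite //= inE => /norP[].
Qed.

(** The proof rule for loops. Besides the invariant, each pass may rely on the value of the counter
    and on everything that the loop does not assign being as it was before the loop. *)
Lemma eval_For (I : nat -> config -> Prop) x y c s :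
  wf (CFor x y c) -> I 0 (setv s x 0) ->
  (forall i s', i < var s y -> var s' x = i -> frame (CFor x y c) s s' ->
     I i s' -> I i.+1 (setv (eval c s') x i.+1)) ->
  I (var s y) (eval (CFor x y c) s).
Proof.
move=> /and4P[x2 y2 xc wfc] I0 IS /=; set n := var s y in IS *.
have setv_frame s' s'' v : frame (CFor x y c) s s' -> frame c s' s'' ->
    frame (CFor x y c) s (setv s'' x v).
  move=> fr fr' a i ai; rewrite -(frame_For fr fr' ai) /= /updm.
  by case: (a == 0) ai; rewrite //= inE => /norP[/negPf ->].
suff: forall i, i <= n -> let s' := iter i (fun s' => let s'' := eval c s' in
   setv s'' x (var s'' x).+1) (setv s x 0) in
   [/\ var s' x = i, frame (CFor x y c) s s' & I i s'].
  by case/(_ n (leqnn n)).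
elim=> [|i IHi] i_n /=; first by split=> //; [rewrite /updm !eqxx | apply: setv_frame].
have [s'x s'f Is'] := IHi (ltnW i_n).
rewrite [var (eval _ _) _](eval_frame _ wfc) ?s'x //; split; last exact: IS.
  by rewrite /= /updm !eqxx.
exact/(setv_frame _ _ _ s'f)/eval_frame.
Qed.

Fixpoint prints (c : cmd) : bool :=
  match c with
  | CPrint _ => true
  | CSeq c1 c2 | CIf _ c1 c2 => prints c1 || prints c2
  | CFor _ _ c => prints c
  | _ => false
  end.

Lemma eval_printed c s : ~~ prints c -> printed (eval c s) = printed s.
Proof.
elim: c s => //= [c1 IH1 c2 IH2 s|x c1 IH1 c2 IH2 s|x y c IH s].
- by case/norP=> pr1 pr2; rewrite IH2 ?IH1.
- by case/norP=> pr1 pr2; case: ifP => _; rewrite ?IH1 ?IH2.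
- by move=> pr; elim: (var s y) => //= n IHn; rewrite IH.
Qed.

(* Row 7 is left to the temporaries of the compiler. *)
Definition loc (a i : nat) := 8 * i + a.
Definition tmp1 := loc 7 0.
Definition tmp2 := loc 7 1.

(** Three doublings replace the multiplication by 8, which the machine does not offer. *)
Definition addr (a i : nat) :=
  [:: Add tmp1 (loc 0 i) (loc 0 i); Add tmp1 tmp1 tmp1; Add tmp1 tmp1 tmp1;
      Const tmp2 a; Add tmp1 tmp1 tmp2].

Fixpoint len (c : cmd) : nat :=
  match c with
  | CSkip => 0
  | CSet _ _ | CAdd _ _ _ | CSub _ _ _ | CRead _ | CPrint _ => 1
  | CLoad _ _ _ | CSave _ _ _ => 6
  | CSeq c1 c2 => len c1 + len c2
  | CIf _ c1 c2 => len c2 + len c1 + 3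
  | CFor _ _ c => len c + 7
  end.

(** Jumps are absolute, so the address [l] of the code is a parameter. An unconditional jump tests a
    temporary that was just set to 1. The test of a loop stands after its body and is entered first,
    so that a loop of length 0 is skipped. *)
Fixpoint compile (l : nat) (c : cmd) : seq instr :=
  match c with
  | CSkip => [::]
  | CSet x n => [:: Const (loc 0 x) n]
  | CAdd x y z => [:: Add (loc 0 x) (loc 0 y) (loc 0 z)]
  | CSub x y z => [:: Defs.Sub (loc 0 x) (loc 0 y) (loc 0 z)]
  | CLoad x a i => addr a i ++ [:: Fetch (loc 0 x) tmp1]
  | CSave a i x => addr a i ++ [:: Store tmp1 (loc 0 x)]
  | CRead x => [:: Read (loc 0 x)]
  | CPrint x => [:: Print (loc 0 x)]
  | CSeq c1 c2 => compile l c1 ++ compile (l + len c1) c2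
  | CIf x c1 c2 =>
      Jump (loc 0 x) (l + len c2 + 3)
      :: compile l.+1 c2
      ++ Const tmp1 1 :: Jump tmp1 (l + len c2 + len c1 + 3)
      :: compile (l + len c2 + 3) c1
  | CFor x y c =>
      [:: Const (loc 0 x) 0; Const tmp1 1; Jump tmp1 (l + len c + 5)]
      ++ compile (l + 3) c
      ++ [:: Const tmp1 1; Add (loc 0 x) (loc 0 x) tmp1;
             Defs.Sub tmp1 (loc 0 y) (loc 0 x); Jump tmp1 (l + 3)]
  end.

Lemma size_compile l c : size (compile l c) = len c.
Proof.
elim: c l => //= [c1 IH1 c2 IH2 l|x c1 IH1 c2 IH2 l|x y c IH l].
- by rewrite size_cat IH1 IH2.
- by rewrite size_cat /= IH1 IH2; lia.
- by rewrite size_cat /= IH; lia.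
Qed.

Definition code_at (P : program) (l : nat) (code : seq instr) :=
  forall k, k < size code -> onth P (l + k) = onth code k.

Lemma code_at_cons P l i code : code_at P l (i :: code) ->
  onth P l = Some i /\ code_at P l.+1 code.
Proof.
move=> cP; split=> [|k k_lt]; first by rewrite -[l]addn0 cP.
by rewrite addSnnS cP.
Qed.

Lemma code_at_cat P l code1 code2 : code_at P l (code1 ++ code2) ->
  code_at P l code1 /\ code_at P (l + size code1) code2.
Proof.
move=> cP; split=> k k_lt.
  by rewrite cP ?size_cat ?ltn_addr // onth_cat k_lt.
rewrite -addnA cP ?size_cat ?ltn_add2l // onth_cat ltnNge leq_addr /=.
by rewrite addKn.
Qed.

Definition repr (m : memory) (r : nat -> nat) :=
  forall a i, a < 7 -> r (loc a i) = m a i.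

Lemma upd_same r i v : upd r i v i = v.
Proof. by rewrite /upd eqxx. Qed.

Lemma repr_upd m r a i v : a < 7 -> repr m r ->
  repr (updm m a i v) (upd r (loc a i) v).
Proof.
move=> a7 mr a' i' a'7; rewrite /upd /updm /loc mr //.
by have -> : (8 * i' + a' == 8 * i + a) = (a' == a) && (i' == i) by lia.
Qed.

Lemma repr_tmp m r i v : repr m r -> repr m (upd r (loc 7 i) v).
Proof.
move=> mr a' i' a'7; rewrite /upd mr // /loc.
by have -> : (8 * i' + a' == 8 * i + 7) = false by lia.
Qed.

(** The indeterminate stands for a common bound on the read-only variables, hence on the length of
    every loop. *)
Fixpoint step_bound (c : cmd) : {poly nat} :=
  match c with
  | CSkip => 0%R
  | CSet _ _ | CAdd _ _ _ | CSub _ _ _ | CRead _ | CPrint _ => 1%R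
  | CLoad _ _ _ | CSave _ _ _ => (6%:P)%R
  | CSeq c1 c2 => (step_bound c1 + step_bound c2)%R
  | CIf _ c1 c2 => (step_bound c1 + step_bound c2 + 3%:P)%R
  | CFor _ _ c => ('X * (step_bound c + 4%:P) + 5%:P)%R
  end.

Lemma reach_step P n c l r x y s :
  onth P l = Some c -> reach P n (step c (State l r x y)) s ->
  reach P n.+1 (State l r x y) s.
Proof. by move=> lP; apply: (@reachS _ _ c (State l r x y)). Qed.

Lemma reach_addr P l a i m r x y : code_at P l (addr a i) -> repr m r ->
  exists r', [/\ reach P 5 (State l r x y) (State (l + 5) r' x y), repr m r'
    & r' tmp1 = loc a (m 0 i)].
Proof.
move=> /code_at_cons[P1 /code_at_cons[P2 /code_at_cons[P3
  /code_at_cons[P4 /code_at_cons[P5 _]]]]] mr.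
eexists; split.
- apply: (reach_step P1); apply: (reach_step P2); apply: (reach_step P3).
  apply: (reach_step P4); apply: (reach_step P5); rewrite /= (addnC l).
  exact: reach0.
- by do 5!apply: repr_tmp.
- by rewrite /upd /= mr // /loc; lia.
Qed.

(** By induction on the command. No command changes the variables 0, 1 and 2, so the bound [N] on
    loop lengths passes on to all parts. *)
Lemma compile_correct P N c l s r : wf c -> code_at P l (compile l c) ->
  (forall y, y <= 2 -> var s y <= N) -> repr (mem s) r ->
  exists n r', [/\ n <= (step_bound c).[N]%R,
    reach P n (State l r (unread s) (printed s))
      (State (l + len c) r' (unread (eval c s)) (printed (eval c s)))
  & repr (mem (eval c s)) r'].
Proof.
have frame c' s' y : wf c' -> y <= 2 -> var (eval c' s') y = var s' y.
  move=> wfc y2; rewrite eval_frame //=; elim: c' wfc {s'} => //=.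
  - by move=> z n z2; rewrite inE; lia.
  - by move=> z n n' z2; rewrite inE; lia.
  - by move=> z n n' z2; rewrite inE; lia.
  - by move=> z n n' /andP[z2 _]; rewrite inE; lia.
  - by move=> z z2; rewrite inE; lia.
  - by move=> c1 IH1 c2 IH2 /andP[? ?]; rewrite mem_cat negb_or IH1 ?IH2.
  - by move=> z c1 IH1 c2 IH2 /andP[? ?]; rewrite mem_cat negb_or IH1 ?IH2.
  - by move=> z z' c' IH /and4P[? ? ? ?]; rewrite inE negb_or IH // andbT; lia.
elim: c l s r => [|x n|x y z|x y z|x a i|a i x|x|x|c1 IH1 c2 IH2|x c1 IH1 c2 IH2|
  x y c IH] l s r.
- by exists 0, r; split=> //=; rewrite addn0; apply: reach0.
- move=> x2 /code_at_cons[P1 _] sN mr; exists 1; eexists; split.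
  + by rewrite /= hornerC.
  + by apply: (reach_step P1); rewrite /= addn1; apply: reach0.
  + exact: repr_upd.
- move=> x2 /code_at_cons[P1 _] sN mr; exists 1; eexists; split.
  + by rewrite /= hornerC.
  + by apply: (reach_step P1); rewrite /= addn1; apply: reach0.
  + by rewrite !mr //; apply: repr_upd.
- move=> x2 /code_at_cons[P1 _] sN mr; exists 1; eexists; split.
  + by rewrite /= hornerC.
  + by apply: (reach_step P1); rewrite /= addn1; apply: reach0.
  + by rewrite !mr //; apply: repr_upd.
- move=> /andP[x2 a7] /code_at_cat[Pa /code_at_cons[P1 _]] sN mr.
  have [r' [lr' mr' r't]] := reach_addr (unread s) (printed s) Pa mr.
  exists (5 + 1); eexists; split.
  + by rewrite /= hornerC.
  + apply: reach_trans lr' _; apply: (reach_step P1).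
    by rewrite /= -addnS; apply: reach0.
  + by rewrite r't mr' //; apply: repr_upd.
- move=> /andP[a0 a7] /code_at_cat[Pa /code_at_cons[P1 _]] sN mr.
  have [r' [lr' mr' r't]] := reach_addr (unread s) (printed s) Pa mr.
  exists (5 + 1); eexists; split.
  + by rewrite /= hornerC.
  + apply: reach_trans lr' _; apply: (reach_step P1).
    by rewrite /= -addnS; apply: reach0.
  + by rewrite r't mr' //; apply: repr_upd.
- move=> x2 /code_at_cons[P1 _] sN mr; exists 1; eexists; split.
  + by rewrite /= hornerC.
  + by apply: (reach_step P1); rewrite /= addn1; apply: reach0.
  + exact: repr_upd.
- move=> x2 /code_at_cons[P1 _] sN mr; exists 1; eexists; split.
  + by rewrite /= hornerC.
  + by apply: (reach_step P1); rewrite /= addn1 mr //; apply: reach0.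
  + by [].
- move=> /= /andP[wf1 wf2] /code_at_cat[P1 P2] sN mr.
  have [n1 [r1 [n1_le lr1 mr1]]] := IH1 _ _ _ wf1 P1 sN mr.
  rewrite size_compile in P2.
  have sN' y : y <= 2 -> var (eval c1 s) y <= N by move=> y2; rewrite frame ?sN.
  have [n2 [r2 [n2_le lr2 mr2]]] := IH2 _ _ _ wf2 P2 sN' mr1.
  exists (n1 + n2), r2; split=> //; first by rewrite hornerD leq_add.
  by rewrite addnA; apply: reach_trans lr1 lr2.
- move=> /= /andP[wf1 wf2] /code_at_cons[P1].
  move=> /code_at_cat[P2 /code_at_cons[P3 /code_at_cons[P4 P5]]] sN mr.
  rewrite size_compile in P3 P4 P5.
  rewrite !hornerD hornerC; case: ifP => [x_gt0 | /negbT x0].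
    have eq_l : (l.+1 + len c2).+2 = l + len c2 + 3 by lia.
    rewrite eq_l in P5.
    have [n1 [r1 [n1_le lr1 mr1]]] := IH1 _ _ _ wf1 P5 sN mr.
    exists n1.+1, r1; split=> //.
      by move: n1_le => /= n1_le; rewrite -[GRing.add _ _]/(_ + _)%N; lia.
    apply: (reach_step P1) => /=; rewrite mr // x_gt0.
    by have -> : l + (len c2 + len c1 + 3) = l + len c2 + 3 + len c1 by lia.
  have [n2 [r2 [n2_le lr2 mr2]]] := IH2 _ _ _ wf2 P2 sN mr.
  exists (1 + (n2 + 2)); eexists; split.
  + by rewrite -[GRing.add _ _]/(_ + _)%N; lia.
  + apply: (reach_trans (s2 := State l.+1 r (unread s) (printed s))).
      by apply: (reach_step P1); rewrite /= mr // (negPf x0); apply: reach0.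
    apply: reach_trans lr2 _; apply: (reach_step P3).
    apply: (reach_step P4) => /=.
    have -> : l + (len c2 + len c1 + 3) = l + len c2 + len c1 + 3 by lia.
    exact: reach0.
  + exact: repr_tmp.
- move=> wfF; have /and4P[x2 y2 xc wfc] := wfF.
  move=> /= /code_at_cons[P1 /code_at_cons[P2 /code_at_cons[P3]]].
  move=> /code_at_cat[P4 /code_at_cons[P5 /code_at_cons[P6]]].
  move=> /code_at_cons[P7 /code_at_cons[P8 _]] sN mr.
  rewrite size_compile in P5 P6 P7 P8.
  set f := fun s' : config => _.
  have eq_l : l.+3 = l + 3 by lia.
  have eq_t : (l.+3 + len c).+2 = l + len c + 5 by lia.
  have eq_t2 : (l + 3 + len c).+2 = l + len c + 5 by lia.
  rewrite eq_t in P7 P8; rewrite eq_l in P4 P5 P6.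
  pose final i := iter i f (setv s x 0).
  have final_y i z : z <= 2 -> var (final i) z = var s z.
    move=> z2; have xz : (z == x) = false by lia.
    by elim: i => [|i IHi]; rewrite /= /updm /= xz ?frame.
  have final_x i : var (final i) x = i.
    elim: i => [|i IHi]; rewrite /= /updm /= eqxx //.
    by rewrite eval_frame ?IHi.
  (* The run of a loop is cut at its test: three instructions lead there, each pass takes the two of
     the test, the body and the two that increase the counter, and a last failing test takes two
     more. *)
  pose test := l + len c + 5.
  suff loop i : i <= var s y -> exists n r', [/\ n <= i * ((step_bound c).[N]%R + 4),
      reach P n (State test (upd (upd r (loc 0 x) 0) tmp1 1) (unread s) (printed s))
        (State test r' (unread (final i)) (printed (final i)))
      & repr (mem (final i)) r'].
    have [n [r' [n_le loopP mr']]] := loop _ (leqnn _).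
    exists (3 + (n + 2)); eexists; split.
    + rewrite !(hornerD, hornerM, hornerX, hornerC).
      rewrite -[X in _ <= X]/(N * ((step_bound c).[N]%R + 4) + 5).
      by have := leq_trans n_le (leq_mul (sN _ y2) (leqnn _)); lia.
    + apply: (reach_trans (s2 := State test (upd (upd r (loc 0 x) 0) tmp1 1)
                                   (unread s) (printed s))).
        apply: (reach_step P1); apply: (reach_step P2).
        apply: (reach_step P3); exact: reach0.
      apply: reach_trans loopP _; apply: (reach_step P7).
      have -> : l + (len c + 7) = test.+2 by rewrite /test; lia.
      apply: (reach_step P8) => /=; rewrite !mr' // final_y // final_x subnn.
      exact: reach0.
    + exact: repr_tmp.
  elim: i => [_ | i IHi i_lt].
    exists 0; eexists; split=> //; first exact: reach0.
    exact/repr_tmp/repr_upd.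
  have [n [r1 [n_le loopP mr1]]] := IHi (ltnW i_lt).
  have sN' z : z <= 2 -> var (final i) z <= N by move=> z2; rewrite final_y ?sN.
  have [n2 [r2 [n2_le bodyP mr2]]] := IH _ _ _ wfc P4 sN' (repr_tmp 0 (var s y - i) mr1).
  exists (n + (2 + (n2 + 2))); eexists; split.
  + by rewrite mulSn; lia.
  + apply: reach_trans loopP _.
    apply: (reach_trans (s2 := State (l + 3) (upd r1 tmp1 (var s y - i))
                                 (unread (final i)) (printed (final i)))).
      apply: (reach_step P7); apply: (reach_step P8) => /=.
      rewrite !mr1 // final_y // final_x upd_same subn_gt0 i_lt; exact: reach0.
    apply: reach_trans bodyP _; apply: (reach_step P5).
    by apply: (reach_step P6) => /=; rewrite eq_t2; apply: reach0.
  + rewrite /= -/(final i) -[X in updm _ 0 x X]addn1.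
    have -> : var (eval c (final i)) x = upd r2 tmp1 1 (loc 0 x).
      by rewrite (repr_tmp 0 1 mr2).
    have {2}-> : 1 = upd r2 tmp1 1 tmp1 by rewrite upd_same.
    by apply: repr_upd => //; apply: repr_tmp.
Qed.

(** * Polynomial running time of compiled commands *)

Definition init_mem (n1 n2 n3 : nat) : memory :=
  fun a i => if a == 0 then nth 0 [:: n1; n2; n3] i else 0.

Lemma leq_sum_const P i c :
  onth P i = Some c -> instr_const c <= \sum_(c' <- P) instr_const c'.
Proof.
elim: P i => [|c' P IH] [|i] //=; rewrite big_cons.
  by move=> [->]; apply: leq_addr.
by move=> /IH /leq_trans -> //; apply: leq_addl.
Qed.

(** Three leading [Read] instructions put the loop bounds into the read-only variables. The bounds
    are given in binary, so loops are polynomially long only because of the hypothesis on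
    [n1 + n2 + n3]. *)
Lemma program_of_cmd c : wf c -> exists (P : program) (p : {poly nat}),
  forall n1 n2 n3 xs, let x := [:: n1, n2, n3 & xs] in
    n1 + n2 + n3 <= bitsize x ->
  exists2 t, computes_in_time P x t
      (printed (eval c (Config (init_mem n1 n2 n3) xs [::])))
    & t <= (p.[bitsize x])%R.
Proof.
move=> wfc.
set P := [:: Read (loc 0 0); Read (loc 0 1); Read (loc 0 2)] ++ compile 3 c.
set K := \sum_(i <- P) instr_const i.
have leK i ins := @leq_sum_const P i ins.
pose q := (step_bound c + 3%:P)%R : {poly nat}.
(* At most [q] steps are made, the three reads included. All numbers of the input and all constants
   of the program start with at most [N + K.+1] bits, where [N] is the input size, and gain at most
   one bit per step. *)
exists P, (q * (2%:P * ('X + (K.+1)%:P + q)))%R.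
move=> n1 n2 n3 xs x n_le; set s0 := Config _ _ _.
set N := bitsize x in n_le *.
have Pc : code_at P 3 (compile 3 c).
  by move=> k k_lt; rewrite /P onth_cat ltnNge /= addKn.
pose r := upd (upd (upd (fun=> 0) (loc 0 0) n1) (loc 0 1) n2) (loc 0 2) n3.
have mr : repr (mem s0) r.
  move=> a i a7; rewrite /r /upd /loc /= /init_mem.
  have -> : (8 * i + a == 16) = (a == 0) && (i == 2) by lia.
  have -> : (8 * i + a == 8) = (a == 0) && (i == 1) by lia.
  have -> : (8 * i + a == 0) = (a == 0) && (i == 0) by lia.
  by case: eqP => //= _; case: i => [|[|[|i]]] //=; rewrite nth_nil.
have sN y : y <= 2 -> var s0 y <= N.
  by case: y => [|[|[|]]] //= _; rewrite /init_mem /=; lia.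
have [n [r' [n_le' runP _]]] := compile_correct wfc Pc sN mr.
have {}runP : reach P (3 + n) (State 0 (fun=> 0) x [::])
    (State (3 + len c) r' (unread (eval c s0)) (printed (eval c s0))).
  apply: (reach_step (c := Read (loc 0 0))) => //.
  apply: (reach_step (c := Read (loc 0 1))) => //.
  apply: (reach_step (c := Read (loc 0 2))) => //=; exact: runP.
have xN m : m \in x -> bitlen m <= N.
  by move=> mx; rewrite /N /bitsize (big_rem m mx) leq_addr.
have ltL m L : m <= L -> m < 2 ^ L.
  by move=> mL; apply: leq_trans (ltn_expl m (ltnSn 1)) _; rewrite leq_exp2l.
have PL i ins : onth P i = Some ins -> instr_const ins < 2 ^ (N + K.+1).
  by move=> /leK insK; apply: ltL; lia.
have sL : bounded (N + K.+1) (State 0 (fun=> 0) x [::]).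
  split=> [i | m /xN mN] /=; first by rewrite expn_gt0.
  by apply: leq_trans (ltn_bitlen m) _; rewrite leq_exp2l //; lia.
have L_gt0 : 0 < N + K.+1 by rewrite addnS.
have halt : size P <= pc (State (3 + len c) r' (unread (eval c s0)) (printed (eval c s0))).
  by rewrite /P size_cat size_compile.
have [t exec_t t_le] := exec_of_reach L_gt0 PL sL runP halt.
exists t; first by exists (State (3 + len c) r' (unread (eval c s0)) (printed (eval c s0))).
apply: leq_trans t_le _; rewrite !(hornerM, hornerD, hornerC, hornerX).
rewrite -[X in _ <= X]/(((step_bound c).[N]%R + 3) *
  (2 * (N + K.+1 + ((step_bound c).[N]%R + 3)))).
have le3 : 3 + n <= (step_bound c).[N]%R + 3 by rewrite addnC leq_add2r.
by rewrite (leq_mul le3) // leq_mul // leq_add2l.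
Qed.

(** * The exchange argument for the greedy matrix *)

Lemma sum_delta n k (P : bool) : k < n -> \sum_(j < n) (P && (j == k :> nat)) = P.
Proof.
move=> k_n; rewrite (bigD1 (Ordinal k_n)) //= eqxx andbT big1 ?addn0 // => j jk.
by have /negPf -> : (j != k :> nat) by []; rewrite andbF.
Qed.

(** Here [W] is the part of the matrix placed so far, [D] and [r] are the row and column sums still
    missing, and [x] is what completes [W] under the bound [n1] on entries. *)
Definition feasible n1 n2 n3 (D r : nat -> nat) (W : nat -> nat -> nat) :=
  exists x : nat -> nat -> nat,
    [/\ forall i, i < n2 -> \sum_(j < n3) x i j = D i,
        forall j, j < n3 -> \sum_(i < n2) x i j = r j
      & forall i j, i < n2 -> j < n3 -> x i j + W i j <= n1].

(** If a completion has nothing at (b, k), its row b has a unit in some column c, and some other row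
    i has more in column k than in column c. Moving one unit from (b, c) to (b, k) and one from (i,
    k) to (i, c) keeps all sums. The bound survives at (i, c) because row i is untouched and its
    entry there was below the one in column k. *)
Lemma feasible_exchange n1 n2 n3 D r W b k :
  feasible n1 n2 n3 D r W -> b < n2 -> k < n3 -> 0 < D b -> W b k < n1 ->
  (forall j, j < n3 -> W b j < n1 -> r j <= r k) ->
  (forall i j, i < n2 -> j < n3 -> i != b -> 0 < D i -> W i j = 0) ->
  exists x : nat -> nat -> nat,
    [/\ forall i, i < n2 -> \sum_(j < n3) x i j = D i,
        forall j, j < n3 -> \sum_(i < n2) x i j = r j,
        forall i j, i < n2 -> j < n3 -> x i j + W i j <= n1
      & 0 < x b k].
Proof.
move=> [x [xD xr xW]] b_n k_n Db Wk rk W0.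
case: (posnP (x b k)) => [xbk | xbk]; last by exists x.
have [c [c_n xbc]] : exists c, c < n3 /\ 0 < x b c.
  have /existsP[c xbc] : [exists c : 'I_n3, 0 < x b c].
    apply: contraTT Db => /existsPn x0; rewrite -xD // big1 // => c _.
    by apply/eqP; rewrite -leqn0 leqNgt.
  by exists c.
have Wc : W b c < n1 by have := xW _ _ b_n c_n; lia.
(* Otherwise column c dominates column k in every row, strictly in row b, and [r k < r c]
   contradicts the maximality of [r k]. *)
have [i [i_n xi]] : exists i, i < n2 /\ x i c < x i k.
  have /existsP[i xi] : [exists i : 'I_n2, x i c < x i k].
    apply: contraTT (rk _ c_n Wc) => /existsPn xle; rewrite -ltnNge.
    rewrite -!xr // (bigD1 (Ordinal b_n)) //= [ltnRHS](bigD1 (Ordinal b_n)) //=.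
    by rewrite xbk add0n -add1n leq_add // leq_sum // => i _; rewrite leqNgt.
  by exists i.
have ib : (i == b) = false by apply/negbTE; apply: contraTneq xi => ->; rewrite xbk.
have Di : 0 < D i by rewrite -xD // (bigD1 (Ordinal k_n)) //=; lia.
have ck : (c == k) = false by apply/negbTE; apply: contraTneq xbc => ->; rewrite xbk.
pose x' i' j := x i' j + ((i' == b) && (j == k)) + ((i' == i) && (j == c))
   - ((i' == b) && (j == c)) - ((i' == i) && (j == k)).
(* Both subtracted units are present, so the subtractions are exact; in this additive form the
   identity can be summed over rows and columns. *)
have xx' i' j : x' i' j + ((i' == b) && (j == c)) + ((i' == i) && (j == k)) =
    x i' j + ((i' == b) && (j == k)) + ((i' == i) && (j == c)).
  rewrite /x'; case: (i' =P b) => ?; case: (i' =P i) => ?;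
    case: (j =P c) => ?; case: (j =P k) => ?; subst=> /=; lia.
exists x'; split.
- move=> i' i'_n; rewrite -xD //.
  suff : \sum_(j < n3) (x' i' j + ((i' == b) && (j == c :> nat)) + ((i' == i) && (j == k :> nat)))
     = \sum_(j < n3) (x i' j + ((i' == b) && (j == k :> nat)) + ((i' == i) && (j == c :> nat))).
    by rewrite !big_split /= !sum_delta //; lia.
  by apply: eq_bigr => j _; apply: xx'.
- move=> j j_n; rewrite -xr //.
  suff : \sum_(i' < n2) (x' i' j + ((j == c) && (i' == b :> nat)) + ((j == k) && (i' == i :> nat)))
     = \sum_(i' < n2) (x i' j + ((j == k) && (i' == b :> nat)) + ((j == c) && (i' == i :> nat))).
    by rewrite !big_split /= !sum_delta //; lia.
  by apply: eq_bigr => i' _; rewrite ![(j == _) && _]andbC; apply: xx'.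
- move=> i' j i'_n j_n; rewrite /x'; have := xW _ _ i'_n j_n.
  have := xW _ _ i_n k_n; have := W0 _ _ i_n c_n; have := W0 _ _ i_n k_n.
  rewrite ib => /(_ isT Di) Wik /(_ isT Di) Wic.
  case: (i' =P b) => ?; case: (i' =P i) => ?;
    case: (j =P c) => ?; case: (j =P k) => ?; subst=> /=; lia.
- by rewrite /x' !eqxx [b == i]eq_sym ib [k == c]eq_sym ck; lia.
Qed.

(** A completion with a positive entry at (b, k), lowered there by one, completes the matrix in
    which that unit has been placed. *)
Lemma feasible_greedy n1 n2 n3 D r W D' r' W' b k :
  feasible n1 n2 n3 D r W -> b < n2 -> k < n3 -> 0 < D b -> W b k < n1 ->
  (forall j, j < n3 -> W b j < n1 -> r j <= r k) ->
  (forall i j, i < n2 -> j < n3 -> i != b -> 0 < D i -> W i j = 0) ->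
  (forall i, D' i = D i - (i == b)) -> (forall j, r' j = r j - (j == k)) ->
  (forall i j, i < n2 -> j < n3 -> W' i j = W i j + ((i == b) && (j == k))) ->
  feasible n1 n2 n3 D' r' W'.
Proof.
move=> fsb b_n k_n Db Wk rk W0 D'E r'E W'E.
have [x [xD xr xW xbk]] := feasible_exchange fsb b_n k_n Db Wk rk W0.
pose x' i j := x i j - ((i == b) && (j == k)).
have xx' i j : x i j = x' i j + ((i == b) && (j == k)).
  by rewrite /x'; case: (i =P b) => ?; case: (j =P k) => ?; subst=> /=; lia.
exists x'; split.
- move=> i i_n; rewrite D'E -xD //.
  have -> : \sum_(j < n3) x i j = \sum_(j < n3) (x' i j + ((i == b) && (j == k :> nat))).
    by apply: eq_bigr.
  by rewrite big_split /= sum_delta // addnK.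
- move=> j j_n; rewrite r'E -xr //.
  have -> : \sum_(i < n2) x i j = \sum_(i < n2) (x' i j + ((j == k) && (i == b :> nat))).
    by apply: eq_bigr => i _; rewrite andbC.
  by rewrite big_split /= sum_delta // addnK.
- by move=> i j i_n j_n; rewrite W'E //; have := xW _ _ i_n j_n; have := xx' i j; lia.
Qed.

(** * The program *)

Local Notation xn1 := 0 (only parsing).
Local Notation xn2 := 1 (only parsing).
Local Notation xn3 := 2 (only parsing).
Local Notation xb := 3 (only parsing).
Local Notation xc := 4 (only parsing).
Local Notation xi := 5 (only parsing).
Local Notation xj := 6 (only parsing).
Local Notation xk := 7 (only parsing).
Local Notation xmax := 8 (only parsing).
Local Notation xbest := 9 (only parsing).
Local Notation xr := 10 (only parsing).
Local Notation xu := 11 (only parsing).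
Local Notation xt := 12 (only parsing).
Local Notation xd := 13 (only parsing).
Local Notation xe := 14 (only parsing).
Local Notation xrow := 15 (only parsing).
Local Notation xzero := 16 (only parsing).
Local Notation xone := 17 (only parsing).
Local Notation xflag := 18 (only parsing).
Local Notation xsum1 := 19 (only parsing).
Local Notation xsum2 := 20 (only parsing).
Local Notation xpair := 21 (only parsing).

(* In the first phase ([f = false]) a unit of the demand of a vertex [b] goes
   to a column [k] of the matrix W; in the second one ([f = true]) a unit of
   W(b, c) goes to a vertex [k] of the first class. *)
Definition dem (f : bool) := if f then 4 else 2.
Definition idx (f : bool) := if f then xpair else xb.
Definition res (f : bool) := if f then 1 else 3.
Definition use (f : bool) := if f then 5 else 4.
Definition off (f : bool) := if f then xzero else xrow.
Definition num (f : bool) := if f then xn1 else xn3.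
Definition cap (f : bool) := if f then xone else xn1.

(** A strict inequality is a positive truncated difference, and adding [xzero] copies a variable. As
    the comparison with [xmax] is strict, a slot with nothing remaining is never chosen. *)
Definition compare f :=
  CLoad xr (res f) xk ;; CAdd xt (off f) xk ;; CLoad xu (use f) xt ;;
  CSub xd (cap f) xu ;; CSub xe xr xmax ;;
  CIf xd (CIf xe (CAdd xmax xr xzero ;; CAdd xbest xk xzero) CSkip) CSkip.

Definition pick f := CSet xmax 0 ;; CFor xk (num f) (compare f).

Definition dec a y := CLoad xd a y ;; CSub xd xd xone ;; CSave a y xd.
Definition inc a y := CLoad xd a y ;; CAdd xd xd xone ;; CSave a y xd.

Definition transfer f :=
  dec (dem f) (idx f) ;; dec (res f) xbest ;;
  CAdd xt (off f) xbest ;; inc (use f) xt ;;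
  if f then CPrint xbest ;; CPrint xb ;; CPrint xc else CSkip.

Definition try_transfer f :=
  CLoad xd (dem f) (idx f) ;; CIf xd (CIf xmax (transfer f) CSkip) CSkip.

Definition move f := pick f ;; try_transfer f.

Definition get f (s : config) k := mem s (res f) k.
Definition used f (s : config) k := mem s (use f) (var s (off f) + k).

(** * Correctness of one greedy move *)

Definition consts (s : config) := var s xzero = 0 /\ var s xone = 1.


(** The value [m = 0] signals that no admissible slot has anything remaining; [best] is meaningless
    then. *)
Definition max_at f (s : config) n m best :=
  (forall k, k < n -> used f s k < var s (cap f) -> get f s k <= m) /\
  (0 < m -> [/\ best < n, used f s best < var s (cap f) & get f s best = m]).

Lemma pick_spec f s : consts s ->
  let s' := eval (pick f) s in
  max_at f s (var s (num f)) (var s' xmax) (var s' xbest).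
Proof.
move=> [s0 s1]; set s2 := setv s xmax 0.
rewrite -[eval _ _]/(eval (CFor xk (num f) (compare f)) s2).
have <- : var s2 (num f) = var s (num f) by case: f.
apply: (@eval_For (fun n s' => max_at f s n (var s' xmax) (var s' xbest))); [by clear; case: f | by split |].
move=> i s' i_lt s'i fr [le_max max_ok].
have sE a x : (if a == 0 then (x < xk) || (xe < x) else true) -> mem s' a x = mem s a x.
  move=> ax; rewrite fr; last by clear -ax; case: f; case: a ax => //= ax; rewrite !inE; lia.
  by case: a ax => [|a] ax //; rewrite /s2 /= /updm /=; case: eqP => // x8; subst x.
have s'0 : var s' xzero = 0 by rewrite sE.
have usedE : mem s' (use f) (var s' (off f) + i) = used f s i.
  by rewrite /used !sE //; clear; case: f.
have getE : mem s' (res f) i = get f s i by rewrite /get sE //; clear; case: f.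
have capE : var s' (cap f) = var s (cap f) by rewrite sE //; clear; case: f.
clear -s'i s'0 usedE getE capE le_max max_ok.
set s3 := setv _ _ _.
have [maxE bestE] : let gt := (used f s i < var s (cap f)) && (var s' xmax < get f s i) in
    var s3 xmax = (if gt then get f s i else var s' xmax) /\
    var s3 xbest = (if gt then i else var s' xbest).
  rewrite /s3 /= -usedE -getE -capE.
  by case: f {le_max max_ok usedE getE capE s3}; rewrite /= /updm /= s'i !subn_gt0;
    case: ifP => //= _; case: ifP => //= _; rewrite ?s'0 ?addn0.
rewrite maxE bestE; case: ifP => [/andP[ui gi] | /negbT].
  split=> [k|_]; last by rewrite ltnSn.
  rewrite ltnS leq_eqVlt => /predU1P[-> // | ki uk].
  exact: leq_trans (le_max _ ki uk) (ltnW gi).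
rewrite negb_and -!leqNgt => uigi; split=> [k|m0].
  rewrite ltnS leq_eqVlt => /predU1P[-> ui | ki uk]; last exact: le_max.
  by case/orP: uigi => //; rewrite leqNgt ui.
by have [bi ub gb] := max_ok m0; rewrite ltnW.
Qed.

(** [Stuck] covers a satisfied demand as well as the lack of an admissible slot. In [Moved] the two
    decreased entries are positive, so their truncated subtractions are exact. *)
Variant move_result f (s s' : config) : Prop :=
| Stuck of mem s (dem f) (var s (idx f)) = 0 \/
      (forall k, k < var s (num f) -> used f s k < var s (cap f) -> get f s k = 0)
    & (forall a i, 0 < a -> mem s' a i = mem s a i)
    & printed s' = printed s
| Moved k of k < var s (num f) & 0 < mem s (dem f) (var s (idx f))
    & used f s k < var s (cap f) & 0 < get f s k
    & (forall j, j < var s (num f) -> used f s j < var s (cap f) ->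
         get f s j <= get f s k)
    & (forall i, mem s' (dem f) i = mem s (dem f) i - (i == var s (idx f)))
    & (forall i, mem s' (res f) i = mem s (res f) i - (i == k))
    & (forall i, mem s' (use f) i = mem s (use f) i + (i == var s (off f) + k))
    & printed s' =
        printed s ++ (if f then [:: k; var s xb; var s xc] else [::]).

Lemma wf_pick f : wf (pick f). Proof. by case: f. Qed.

Lemma printed_pick f s : printed (eval (pick f) s) = printed s.
Proof. by rewrite eval_printed //; case: f. Qed.

Definition only_xd (s s' : config) :=
  (forall x, x != xd -> var s' x = var s x) /\ printed s' = printed s.

Lemma dec_spec a y s : 0 < a -> y != xd -> var s xone = 1 ->
  let s' := eval (dec a y) s in only_xd s s' /\
  forall a' i, 0 < a' ->
    mem s' a' i = mem s a' i - ((a' == a) && (i == var s y)).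
Proof.
case: a => // a _ yd s1; split; first by split=> // x /negPf xd /=; rewrite /updm /= xd.
move=> [|a'] i // _; rewrite /= /updm /= (negPf yd) s1.
by case: andP => [[/eqP -> /eqP ->] | ] //=; rewrite subn0.
Qed.

Lemma inc_spec a y s : 0 < a -> y != xd -> var s xone = 1 ->
  let s' := eval (inc a y) s in only_xd s s' /\
  forall a' i, 0 < a' ->
    mem s' a' i = mem s a' i + ((a' == a) && (i == var s y)).
Proof.
case: a => // a _ yd s1; split; first by split=> // x /negPf xd /=; rewrite /updm /= xd.
move=> [|a'] i // _; rewrite /= /updm /= (negPf yd) s1.
by case: andP => [[/eqP -> /eqP ->] | ] //=; rewrite addn0.
Qed.

Lemma transfer_spec f s : consts s ->
  let s' := eval (transfer f) s in
  (forall a i, 0 < a -> mem s' a i =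
     mem s a i - ((a == dem f) && (i == var s (idx f)))
       - ((a == res f) && (i == var s xbest))
       + ((a == use f) && (i == var s (off f) + var s xbest))) /\
  printed s' = printed s ++
    (if f then [:: var s xbest; var s xb; var s xc] else [::]).
Proof.
move=> [s0 s1]; rewrite /transfer.
set last := if f then _ else _.
rewrite -[eval _ s]/(eval last (eval (inc (use f) xt) (setv
  (eval (dec (res f) xbest) (eval (dec (dem f) (idx f)) s)) xt
    (var (eval (dec (res f) xbest) (eval (dec (dem f) (idx f)) s)) (off f) +
     var (eval (dec (res f) xbest) (eval (dec (dem f) (idx f)) s)) xbest)))).
have [[v2 p2] m2] : only_xd s _ /\ _ := @dec_spec (dem f) (idx f) s ltac:(by case: (f)) ltac:(by case: (f)) s1.
move: (eval (dec _ _) s) v2 p2 m2 => s2 v2 p2 m2.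
have s21 : var s2 xone = 1 by rewrite v2.
have [[v3 p3] m3] := @dec_spec (res f) xbest s2 ltac:(by case: (f)) isT s21.
move: (eval (dec _ _) s2) v3 p3 m3 => s3 v3 p3 m3.
set s4 := setv s3 xt (var s3 (off f) + var s3 xbest).
have off_d : off f != xd by case: (f).
have m4 a i : 0 < a -> mem s4 a i = mem s3 a i by case: a.
have t4 : var s4 xt = var s (off f) + var s xbest.
  by rewrite /s4 /= /updm /= !v3 // !v2.
have s41 : var s4 xone = 1 by rewrite /s4 /= /updm /= v3.
have [[v5 p5] m5] := @inc_spec (use f) xt s4 ltac:(by case: (f)) isT s41.
move: (eval (inc _ _) s4) v5 p5 m5 => s5 v5 p5 m5.
have last_mem : mem (eval last s5) = mem s5 by rewrite /last; case: (f).
split; first by move=> a i a_gt0; rewrite last_mem m5 // t4 m4 // m3 // m2 // v2.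
have var5 x : x != xd -> x != xt -> var s5 x = var s x.
  move=> xd xt; rewrite v5 // /s4 /= /updm /= (negPf xt) v3 ?v2 //.
rewrite /last; case: (f) => /=; last by rewrite cats0 p5 /= p3.
by rewrite !var5 // p5 /= p3 p2 -!cats1 -!catA.
Qed.

Lemma move_spec f s : consts s -> move_result f s (eval (move f) s).
Proof.
move=> cs; have [le_max max_ok] := pick_spec f cs; case: cs => s0 s1.
have pr := printed_pick f s.
have fr a x : (if a == 0 then (x < xk) || (xe < x) else true) ->
    mem (eval (pick f) s) a x = mem s a x.
  move=> ax; rewrite (eval_frame _ (wf_pick f)) //; clear -ax.
  by case: f; case: a ax => //= ax; rewrite !inE; lia.
rewrite -[eval _ _]/(eval (try_transfer f) (eval (pick f) s)).
move: (eval (pick f) s) le_max max_ok pr fr => s2 le_max max_ok pr fr.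
rewrite -[eval _ _]/(let s3 := setv s2 xd (mem s2 (dem f) (var s2 (idx f))) in
  if 0 < mem s2 (dem f) (var s2 (idx f)) then
    if 0 < var s2 xmax then eval (transfer f) s3 else s3
  else s3).
have -> : mem s2 (dem f) (var s2 (idx f)) = mem s (dem f) (var s (idx f)).
  by rewrite fr ?[var s2 _]fr //; clear; case: f.
set D := mem s (dem f) (var s (idx f)); set s3 := setv s2 xd D.
have m3 a i : 0 < a -> mem s3 a i = mem s a i.
  by case: a => // a _; rewrite /s3 /= /updm /= fr.
have v3 x : (x < xk) || (xe < x) -> var s3 x = var s x.
  move=> xP; have xd : (x == xd) = false by lia.
  by rewrite /s3 /= /updm /= xd fr.
cbv zeta; have [D0 | D_gt0] := posnP D.
  by apply: Stuck => //; left.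
have [m0 | m_gt0] := posnP (var s2 xmax).
  apply: Stuck => //; right=> k k_n k_u.
  by apply/eqP; rewrite -leqn0 -m0 le_max.
have [b_n b_u b_g] := max_ok m_gt0.
have cs3 : consts s3 by rewrite /consts !v3.
have [m4 p4] := transfer_spec f cs3.
have bE : var s3 xbest = var s2 xbest by [].
have iE : var s3 (idx f) = var s (idx f) by rewrite v3 //; clear; case: f.
have oE : var s3 (off f) = var s (off f) by rewrite v3 //; clear; case: f.
rewrite bE iE oE in m4.
apply: (@Moved _ _ _ (var s2 xbest)) => //; rewrite ?b_g //.
- by move=> i; rewrite m4 ?m3 //; clear; case: f; rewrite //= subn0 addn0.
- by move=> i; rewrite m4 ?m3 //; clear; case: f; rewrite //= subn0 addn0.
- by move=> i; rewrite m4 ?m3 //; clear; case: f; rewrite //= !subn0.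
- by rewrite p4 bE !v3 // -pr.
Qed.

Lemma eq_flat_index n i j i' j' : j < n -> j' < n ->
  (i * n + j == i' * n + j') = (i == i') && (j == j').
Proof.
move=> j_n j'_n; apply/eqP/andP => [eq_ij | [/eqP-> /eqP->] //].
have n_gt0 : 0 < n by apply: leq_ltn_trans j_n.
have := congr1 (divn^~ n) eq_ij; have := congr1 (modn^~ n) eq_ij.
by rewrite !modnMDl !divnMDl // !modn_small // !divn_small // !addn0 => -> ->.
Qed.

(** A remaining demand would give the completion a positive entry in row b; its column is not yet
    full and still has a positive degree, so a move would have been possible. *)
Lemma feasible_stuck n1 n2 n3 D r W b : feasible n1 n2 n3 D r W -> b < n2 ->
  D b = 0 \/ (forall k, k < n3 -> W b k < n1 -> r k = 0) -> D b = 0.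
Proof.
move=> [x [xD xr xW]] b_n [// | r0]; rewrite -xD // big1 // => k _.
have [// | xbk] := posnP (x b k).
have rk : 0 < r k by rewrite -xr // (bigD1 (Ordinal b_n)) //=; lia.
by have := xW _ _ b_n (ltn_ord k); have := r0 _ (ltn_ord k); lia.
Qed.

(** * First phase *)

(* The vector [w] is the matrix W in row-major order, [D] and [r] are the
   unsatisfied degrees.  Rows before [lo] are finished, rows from [hi] on are
   untouched. *)
Record partial_matrix n1 n2 n3 (d2 d3 : nat -> nat) lo hi (D r w : nat -> nat)
  : Prop := PartialMatrix {
  row_sum : forall i, i < n2 -> D i + \sum_(j < n3) w (i * n3 + j) = d2 i;
  col_sum : forall j, j < n3 -> r j + \sum_(i < n2) w (i * n3 + j) = d3 j;
  entry_le : forall i j, i < n2 -> j < n3 -> w (i * n3 + j) <= n1;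
  untouched : forall m, hi * n3 <= m -> w m = 0;
  completable : feasible n1 n2 n3 d2 d3 (fun _ _ => 0) ->
    feasible n1 n2 n3 D r (fun i j => w (i * n3 + j)) /\
    forall i, i < lo -> D i = 0
}.

(** Apart from bookkeeping, this is [feasible_greedy]: if a completion exists, rows before b have no
    demand left, so any other row with a demand lies after b and is still zero. *)
Lemma partial_matrix_transfer n1 n2 n3 d2 d3 b k D r w D' r' w' :
  partial_matrix n1 n2 n3 d2 d3 b b.+1 D r w ->
  b < n2 -> k < n3 -> 0 < D b -> w (b * n3 + k) < n1 -> 0 < r k ->
  (forall j, j < n3 -> w (b * n3 + j) < n1 -> r j <= r k) ->
  (forall i, D' i = D i - (i == b)) -> (forall j, r' j = r j - (j == k)) ->
  (forall m, w' m = w m + (m == b * n3 + k)) ->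
  partial_matrix n1 n2 n3 d2 d3 b b.+1 D' r' w'.
Proof.
move=> [rowD colr wle w0 fsb] b_n k_n Db wk rk rmax D'E r'E w'E.
have w'ij i j : j < n3 -> w' (i * n3 + j) = w (i * n3 + j) + ((i == b) && (j == k)).
  by move=> j_n; rewrite w'E eq_flat_index.
split.
- move=> i i_n; rewrite -rowD //.
  have -> : \sum_(j < n3) w' (i * n3 + j) = \sum_(j < n3) (w (i * n3 + j) + ((i == b) && (j == k :> nat))).
    by apply: eq_bigr => j _; apply: w'ij.
  rewrite big_split /= sum_delta // D'E.
  by case: (i =P b) => ?; subst=> /=; lia.
- move=> j j_n; rewrite -colr //.
  have -> : \sum_(i < n2) w' (i * n3 + j) = \sum_(i < n2) (w (i * n3 + j) + ((j == k) && (i == b :> nat))).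
    by apply: eq_bigr => i _; rewrite andbC; apply: w'ij.
  rewrite big_split /= sum_delta // r'E.
  by case: (j =P k) => ?; subst=> /=; lia.
- move=> i j i_n j_n; rewrite w'ij //; have := wle _ _ i_n j_n.
  by case: (i =P b) => ?; case: (j =P k) => ?; subst=> /=; lia.
- move=> m m_ge; rewrite w'E w0 //.
  by have -> : (m == b * n3 + k) = false by nia.
- move=> /fsb[fsb' lo0]; split; last by move=> i i_b; rewrite D'E lo0.
  apply: (feasible_greedy fsb' b_n k_n Db wk rmax _ D'E r'E).
    move=> i j i_n j_n ib Di; apply: w0.
    have : ~~ (i < b) by apply: contraL Di => /lo0 ->.
    by move: ib; rewrite -leqNgt leq_eqVlt eq_sym => /negPf -> /=; nia.
  by move=> i j _; apply: w'ij.
Qed.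

Definition sizes n1 n2 n3 (s : config) :=
  [/\ var s xn1 = n1, var s xn2 = n2, var s xn3 = n3 & consts s].

(* A row holds at most n1 * n3 units, so this many attempts satisfy the demand
   unless the degree sequence is not graphic. *)
Definition fill_row := CFor xi xn3 (CFor xj xn1 (move false)).
Definition fill_matrix :=
  CSet xrow 0 ;; CFor xb xn2 (fill_row ;; CAdd xrow xrow xn3).

Lemma fill_row_spec n1 n2 n3 d2 d3 b s : sizes n1 n2 n3 s ->
  b < n2 -> var s xb = b -> var s xrow = b * n3 ->
  let inv lo hi s :=
    partial_matrix n1 n2 n3 d2 d3 lo hi (mem s 2) (mem s 3) (mem s 4) in
  inv b b s -> inv b.+1 b.+1 (eval fill_row s).
Proof.
move=> [s_n1 s_n2 s_n3 [s0 s1]] b_n s_b s_row inv inv_s.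
pose possible := feasible n1 n2 n3 d2 d3 (fun _ _ => 0).
(* [t] counts attempts. A successful attempt lowers the demand of row b, and a stuck one shows it to
   be 0 already. This is claimed only if a matrix exists, since otherwise demand may be left
   over. *)
pose I t s' := inv b b.+1 s' /\ (possible -> mem s' 2 b <= n3 * n1 - t).
have I_move t s' : t < n3 * n1 -> frame fill_row s s' -> I t s' ->
    I t.+1 (eval (move false) s').
  move=> t_lt fr [inv_s' le_t].
  have v x : x \notin assigned fill_row -> var s' x = var s x by move=> x_n; apply: fr.
  have cs : consts s' by rewrite /consts !v.
  move: (move_spec false cs); move: (eval (move false) s') => s''.
  case=> [stuck same _ | k].
    rewrite /get /used /= !v // s_b s_row s_n1 s_n3 in stuck.
    have [rowD colr wle w0 fsb] := inv_s'.
    split=> [|/[dup] fsb0 /fsb[fsb' _]]; last first.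
      by rewrite same // (feasible_stuck fsb' b_n stuck).
    split=> [i i_n|j j_n|i j i_n j_n|m m_ge|fsb0].
    - by rewrite same // -rowD //; congr (_ + _); apply: eq_bigr => j _; rewrite same.
    - by rewrite same // -colr //; congr (_ + _); apply: eq_bigr => i _; rewrite same.
    - by rewrite same ?wle.
    - by rewrite same ?w0.
    - have [[x [xD xr xW]] lo0] := fsb fsb0.
      split; last by move=> i i_b; rewrite same ?lo0.
      by exists x; split=> *; rewrite same ?xD ?xr ?xW.
  rewrite /get /used /= !v // s_b s_row s_n1 s_n3.
  move=> k_n Db wk rk rmax D'E r'E w'E _; split.
    exact: partial_matrix_transfer inv_s' b_n k_n Db wk rk rmax D'E r'E w'E.
  by move=> /le_t; rewrite D'E eqxx; lia.
have I_end : I (var s xn3 * n1) (eval fill_row s).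
  apply: (@eval_For (fun i => I (i * n1))) => //.
    split; last first.
      (* Before the first attempt the demand is a row sum of a completion, whose [n3] entries are at
         most [n1]. *)
      case: inv_s => _ _ _ _ fsb /fsb[[x [xD _ xw]] _].
      rewrite mul0n subn0 /= /updm /= -xD // -[n3 in n3 * n1]card_ord -sum_nat_const.
      by apply: leq_sum => j _; apply: leq_trans (leq_addr _ _) (xw _ _ b_n (ltn_ord j)).
    by case: inv_s => ? ? ? w0 ?; split=> // m m_ge; apply: w0; nia.
  move=> i s' i_n s'i fr Ii.
  have s'n1 : var s' xn1 = n1 by rewrite fr.
  have i_lt : i * n1 + n1 <= n3 * n1 by rewrite -mulSnr leq_mul2r -s_n3 i_n orbT.
  have : I (i * n1 + var s' xn1) (eval (CFor xj xn1 (move false)) s').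
    apply: (@eval_For (fun j => I (i * n1 + j))) => //; first by rewrite addn0.
    move=> j s'' j_n s''j fr' Ij; rewrite addnS.
    apply: I_move => //; first by rewrite s'n1 in j_n; lia.
    exact: frame_For fr fr'.
  by rewrite s'n1 -mulSnr.
rewrite s_n3 in I_end.
case: I_end => [[? ? ? w0 fsb] D0]; split=> // /[dup] /fsb [fsb' lo0] /D0.
rewrite subnn leqn0 => /eqP Db; split=> // i; rewrite ltnS leq_eqVlt => /predU1P[-> //|].
exact: lo0.
Qed.

Lemma fill_matrix_spec n1 n2 n3 d2 d3 s : sizes n1 n2 n3 s ->
  (forall i, mem s 2 i = d2 i) -> (forall j, mem s 3 j = d3 j) ->
  (forall m, mem s 4 m = 0) ->
  let s' := eval fill_matrix s in
  partial_matrix n1 n2 n3 d2 d3 n2 n2 (mem s' 2) (mem s' 3) (mem s' 4).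
Proof.
move=> [s_n1 s_n2 s_n3 [s0 s1]] s_d2 s_d3 s_w; set s2 := setv s xrow 0.
rewrite -[eval fill_matrix s]/(eval (CFor xb xn2 (fill_row ;; CAdd xrow xrow xn3)) s2).
(* The offset of row b in the row-major vector is maintained by additions. *)
pose I b s' := var s' xrow = b * n3 /\
  partial_matrix n1 n2 n3 d2 d3 b b (mem s' 2) (mem s' 3) (mem s' 4).
suff: I (var s2 xn2) (eval (CFor xb xn2 (fill_row ;; CAdd xrow xrow xn3)) s2).
  by rewrite [var s2 xn2]s_n2 => -[].
apply: eval_For => //.
  split=> //; rewrite /s2 /= /updm /=.
  split=> [i _|j _|i j _ _|m _|[x [xD xr xW]]].
  - by rewrite s_d2 big1 ?addn0 // => j _; rewrite s_w.
  - by rewrite s_d3 big1 ?addn0 // => i _; rewrite s_w.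
  - by rewrite s_w.
  - by rewrite s_w.
  - split=> //; exists x; split=> [i i_n|j j_n|i j i_n j_n]; first by rewrite s_d2 xD.
      by rewrite s_d3 xr.
    by rewrite s_w xW.
move=> b s' b_n s'b fr [s'row inv_s'].
have v x : x \in [:: xn1; xn2; xn3; xzero; xone] -> var s' x = var s x.
  by rewrite !inE => /or4P[|||/orP[]] /eqP ->; rewrite fr.
have sz : sizes n1 n2 n3 s' by split; rewrite ?v //; split; rewrite v.
have fr' := eval_frame s' (isT : wf fill_row).
rewrite [var s2 xn2]s_n2 in b_n.
have := fill_row_spec sz b_n s'b s'row inv_s'.
rewrite -[eval (fill_row;; _) s']/(let s3 := eval fill_row s' in
  setv s3 xrow (var s3 xrow + var s3 xn3)).
move: (eval fill_row s') fr' => s3 fr' inv_s3.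
split=> //; rewrite /= /updm /= !fr' // s'row.
by case: sz => _ _ -> _; rewrite mulSnr.
Qed.

(** * Second phase *)

Definition edge := (nat * nat * nat)%type.

Definition edge_nats (es : seq edge) : seq nat :=
  flatten [seq [:: e.1.1; e.1.2; e.2] | e <- es].

(* The edges of [es] come from entries of the matrix before [hi], all entries
   before [lo] are used up; [r] and [w] are what remains of [d1] and [w0]. *)
Record partial_listing n1 n2 n3 (d1 w0 : nat -> nat) lo hi (r w : nat -> nat)
  (es : seq edge) : Prop := PartialListing {
  listing_uniq : uniq es;
  listing_range : forall e, e \in es -> [/\ e.1.1 < n1, e.1.2 < n2 & e.2 < n3];
  listing_deg1 : forall a, a < n1 -> r a + count (fun e => e.1.1 == a) es = d1 a;
  listing_pair : forall i j, i < n2 -> j < n3 ->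
    w (i * n3 + j) + count (fun e => (e.1.2 == i) && (e.2 == j)) es =
    w0 (i * n3 + j);
  listing_past : forall e, e \in es -> e.1.2 * n3 + e.2 < hi;
  listing_done : forall m, m < lo -> w m = 0;
  listing_total : \sum_(a < n1) r a = \sum_(i < n2) \sum_(j < n3) w (i * n3 + j)
}.

Lemma partial_listing_transfer n1 n2 n3 d1 w0 b c k r w r' w' es :
  let q := b * n3 + c in partial_listing n1 n2 n3 d1 w0 q q.+1 r w es ->
  b < n2 -> c < n3 -> k < n1 -> 0 < w q -> 0 < r k -> (k, b, c) \notin es ->
  (forall a, r' a = r a - (a == k)) -> (forall m, w' m = w m - (m == q)) ->
  partial_listing n1 n2 n3 d1 w0 q q.+1 r' w' (rcons es (k, b, c)).
Proof.
move=> q [es_uniq es_range es_deg1 es_pair es_past es_done es_total].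
move=> b_n c_n k_n wq rk kes r'E w'E.
have rr' a : r a = r' a + (a == k) by rewrite r'E; case: (a =P k) => ?; subst=> /=; lia.
have ww' i j : j < n3 -> w (i * n3 + j) = w' (i * n3 + j) + ((i == b) && (j == c)).
  move=> j_n; rewrite w'E eq_flat_index //.
  by case: (i =P b) => ?; case: (j =P c) => ?; subst=> /=; rewrite -/q; lia.
split.
- by rewrite rcons_uniq kes.
- by move=> e; rewrite mem_rcons inE => /predU1P[-> | /es_range].
- move=> a a_n; rewrite -es_deg1 // rr' -cats1 count_cat /= [k == a]eq_sym; lia.
- move=> i j i_n j_n; rewrite -es_pair // ww' // -cats1 count_cat /=.
  by rewrite [b == i]eq_sym [c == j]eq_sym; lia.
- by move=> e; rewrite mem_rcons inE => /predU1P[-> /= | /es_past]; rewrite ?ltnSn.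
- by move=> m m_q; rewrite w'E es_done.
(* Both totals drop by exactly one. *)
- apply: (@addIn 1); move: es_total.
  have -> : \sum_(a < n1) r a = \sum_(a < n1) r' a + 1.
    rewrite -[1](@sum_delta n1 k true k_n) -big_split /=.
    by apply: eq_bigr => a _; apply: rr'.
  move=> ->; rewrite -[1](@sum_delta n2 b true b_n) -big_split /=.
  apply: eq_bigr => i _; rewrite -(@sum_delta n3 c (i == b :> nat)) // -big_split /=.
  by apply: eq_bigr => j _; apply: ww'.
Qed.

(** * Almost-regularity under greedy choices *)

Definition almost_regular n (r : nat -> nat) k :=
  forall a, a < n -> r a = k \/ (r a).+1 = k.

(* The invariant while the units of one pair (b, c) are placed: the marked
   vertices, those already joined to (b, c), go down first. *)
Definition levelled n r (mark : nat -> nat) := exists2 k, almost_regular n r k &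
  (forall a, a < n -> 0 < mark a -> (r a).+1 = k) \/
  (forall a, a < n -> mark a = 0 -> r a = k).

(** This is why the second phase cannot get stuck. If all unmarked vertices were at 0, a positive
    degree would sit on a marked vertex i. If the marked vertices are on the lower level, then [r a]
    is at least [r i], which is positive; if the unmarked ones are on the upper level, that level is
    0 and [r i] exceeds it. *)
Lemma levelled_pos n r mark a : levelled n r mark ->
  a < n -> mark a = 0 -> 0 < \sum_(i < n) r i ->
  ~ (forall i, i < n -> mark i = 0 -> r i = 0).
Proof.
move=> [k reg lev] a_n a0 sum_gt0 r0.
have [i [i_n ri]] : exists i, i < n /\ 0 < r i.
  have /existsP[i ri] : [exists i : 'I_n, 0 < r i].
    apply: contraTT sum_gt0 => /existsPn ri0; rewrite big1 // => i _.
    by apply/eqP; rewrite -leqn0 leqNgt.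
  by exists i.
have ra := r0 a a_n a0; have mi : 0 < mark i.
  by rewrite lt0n; apply: contraTneq ri => /r0 ->.
case: lev => [/(_ i i_n mi) | /(_ a a_n a0)]; have := reg a a_n; have := reg i i_n; lia.
Qed.

(** The chosen vertex k leaves the upper level and becomes marked, which preserves either
    alternative. The exception is that k was already on the lower level while all marked vertices
    are there too. *)
Lemma levelled_transfer n r mark r' mark' k : levelled n r mark ->
  k < n -> 0 < r k -> mark k = 0 ->
  (forall a, a < n -> mark a = 0 -> r a <= r k) ->
  (forall a, r' a = r a - (a == k)) -> (forall a, mark' a = mark a + (a == k)) ->
  levelled n r' mark'.
Proof.
move=> [l reg lev] k_n rk mk rmax r'E mark'E.
have cases (P : nat -> Prop) : P k -> (forall a, a < n -> a != k -> P a) ->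
    forall a, a < n -> P a.
  by move=> Pk Pa a a_n; case: (eqVneq a k) => [-> // | /(Pa a a_n)].
have r'k : r' k = (r k).-1 by rewrite r'E eqxx subn1.
have mk' : mark' k = 1 by rewrite mark'E mk eqxx.
have r'a a : a != k -> r' a = r a by rewrite r'E => /negPf ->; rewrite subn0.
have ma a : a != k -> mark' a = mark a by rewrite mark'E => /negPf ->; rewrite addn0.
have regk := reg k k_n.
case: lev => lev; last first.
  have rkl := lev k k_n mk; exists l.
    by apply: cases => [|a a_n ak]; [rewrite r'k; lia | rewrite r'a //; apply: reg].
  by right; apply: cases => [|a a_n ak]; [rewrite mk' | rewrite ma ?r'a //; apply: lev].
case: regk => rkl.
  exists l; first by apply: cases => [|a a_n ak]; [rewrite r'k; lia | rewrite r'a //; apply: reg].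
  by left; apply: cases => [|a a_n ak]; [rewrite r'k; lia | rewrite ma ?r'a //; apply: lev].
(* By the maximality of k the unmarked vertices are on the lower level as well, so [r] is constant.
   That level becomes the new upper one, and the second alternative takes over. *)
have r_const a : a < n -> r a = r k.
  move=> a_n; have := reg a a_n; case: (posnP (mark a)) => [ma0 | ma0].
    by have := rmax a a_n ma0; lia.
  by have := lev a a_n ma0; lia.
exists (r k); first by apply: cases => [|a a_n ak]; [rewrite r'k; lia | rewrite r'a ?r_const //; left].
by right; apply: cases => [|a a_n ak]; [rewrite mk' | rewrite r'a ?r_const].
Qed.

Definition clear_marks := CFor xk xn1 (CSave 5 xk xzero).
(** As no entry of the matrix exceeds [n1], that many attempts suffice for a pair. *)
Definition list_pair := clear_marks ;; CFor xi xn1 (move true).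
Definition list_edges :=
  CSet xpair 0 ;;
  CFor xb xn2 (CFor xc xn3 (list_pair ;; CAdd xpair xpair xone)).

Lemma clear_marks_spec s : consts s ->
  forall a, a < var s xn1 -> mem (eval clear_marks s) 5 a = 0.
Proof.
move=> [s0 _].
apply: (@eval_For (fun n s' => forall a, a < n -> mem s' 5 a = 0)) => //.
move=> i s' _ s'i fr Ii a; rewrite ltnS leq_eqVlt /= /updm /= s'i.
by case: eqP => //= _; [rewrite fr | apply: Ii].
Qed.

Definition listed n1 n2 n3 d1 w0 lo hi s es :=
  partial_listing n1 n2 n3 d1 w0 lo hi (mem s 1) (mem s 4) es /\
  printed s = 1 :: edge_nats es.

Lemma partial_listing_ext n1 n2 n3 d1 w0 lo hi hi' r w r' w' es : hi <= hi' ->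
  r' =1 r -> w' =1 w -> partial_listing n1 n2 n3 d1 w0 lo hi r w es ->
  partial_listing n1 n2 n3 d1 w0 lo hi' r' w' es.
Proof.
move=> le_hi rr ww [es_uniq es_range es_deg1 es_pair es_past es_done es_total].
split=> //.
- by move=> a a_n; rewrite rr es_deg1.
- by move=> i j i_n j_n; rewrite ww es_pair.
- by move=> e /es_past /leq_trans ->.
- by move=> m m_lo; rewrite ww es_done.
- rewrite (eq_bigr (fun a : 'I_n1 => r a)) ?es_total => [|a _]; last exact: rr.
  by apply: eq_bigr => i _; apply: eq_bigr => j _; rewrite ww.
Qed.

Lemma list_pair_spec n1 n2 n3 d1 w0 b c s es : sizes n1 n2 n3 s ->
  b < n2 -> c < n3 -> var s xb = b -> var s xc = c ->
  let q := b * n3 + c in var s xpair = q -> w0 q <= n1 ->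
  listed n1 n2 n3 d1 w0 q q s es -> (exists k, almost_regular n1 (mem s 1) k) ->
  let s' := eval list_pair s in
  exists2 es', listed n1 n2 n3 d1 w0 q.+1 q.+1 s' es'
    & exists k, almost_regular n1 (mem s' 1) k.
Proof.
move=> sz b_n c_n s_b s_c q s_q w0q [lst pr] [k reg].
have fr1 := eval_frame s (isT : wf clear_marks).
have pr1 := eval_printed s (isT : ~~ prints clear_marks).
rewrite -[eval list_pair s]/(eval (CFor xi xn1 (move true)) (eval clear_marks s)).
have [s_n1 s_n2 s_n3 cs] := sz; have := clear_marks_spec cs.
move: (eval clear_marks s) fr1 pr1 => s1 fr1 pr1 s1_mark.
have v1 x : x != xk -> var s1 x = var s x by move=> xP; rewrite fr1 //= inE.
(* The marks record the vertices already joined to (b, c). Marks and remaining units together number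
   at most [n1], so an unmarked vertex exists as long as a unit remains. *)
pose I t s' := exists es', [/\ listed n1 n2 n3 d1 w0 q q.+1 s' es',
  forall a, a < n1 -> mem s' 5 a = ((a, b, c) \in es'),
  \sum_(a < n1) mem s' 5 a + mem s' 4 q <= n1,
  levelled n1 (mem s' 1) (mem s' 5) & mem s' 4 q <= n1 - t].
suff: I (var s1 xn1) (eval (CFor xi xn1 (move true)) s1).
  rewrite v1 // s_n1 => -[es' [[lst' pr'] _ _ [l reg' _]]].
  rewrite subnn leqn0 => /eqP wq0; exists es'; last by exists l.
  split=> //; case: lst' => ? ? ? ? ? dn ?; split=> // m.
  by rewrite ltnS leq_eqVlt => /predU1P[-> // | /dn].
apply: eval_For => //.
  have es_bc a : (a, b, c) \notin es.
    by apply/negP => /(listing_past lst); rewrite /= ltnn.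
  have mem1 a i : a != 0 -> a != 5 -> mem s1 a i = mem s a i.
    by move=> /negPf a0 a5; rewrite fr1 // a0 inE.
  exists es; split.
  - by split; [apply: partial_listing_ext lst => // i; apply: mem1 | rewrite /= pr1].
  - by move=> a a_n; rewrite (negPf (es_bc a)) /= /updm /= s1_mark // s_n1.
  - rewrite big1 => [|a _]; last by rewrite /= /updm /= s1_mark ?s_n1.
    rewrite /= /updm /= mem1 // (leq_trans _ w0q) // -(listing_pair lst b_n c_n).
    exact: leq_addr.
  - exists k; first by move=> a a_n; rewrite /= /updm /= mem1 //; apply: reg.
    (* With no marks yet, the first alternative of [levelled] is vacuous. *)
    by left=> a a_n; rewrite /= /updm /= s1_mark ?s_n1.
  - rewrite subn0 /= /updm /= mem1 // (leq_trans _ w0q) // -(listing_pair lst b_n c_n).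
    exact: leq_addr.
move=> t s' t_n s't fr [es' [[lst' pr'] marks count_marks lev le_t]].
have v x : x \notin xk :: assigned (CFor xi xn1 (move true)) -> var s' x = var s x.
  by rewrite inE => /norP[xk1 xP]; rewrite fr ?v1.
have cs' : consts s' by rewrite /consts !v //; case: cs.
move: (move_spec true cs'); move: (eval (move true) s') => s''.
rewrite v1 // s_n1 in t_n.
have off0 : var s' xzero = 0 by case: cs'.
have cap1 : var s' xone = 1 by case: cs'.
case=> [stuck same pr'' | i].
  (* If a unit remained, there would be an unmarked vertex, and the total of the remaining first
     degrees, equal to that of the matrix, would be positive. By [levelled_pos] a move would then
     have been possible. *)
  have wq0 : mem s' 4 q = 0.
    apply/eqP; rewrite -leqn0 leqNgt; apply/negP => wq.
    have [a [a_n ma]] : exists a, a < n1 /\ mem s' 5 a = 0.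
      have /existsP[a /eqP ma] : [exists a : 'I_n1, mem s' 5 a == 0].
        apply: contraTT count_marks => /existsPn m_gt0; rewrite -ltnNge.
        suff : \sum_(a < n1) 1 <= \sum_(a < n1) mem s' 5 a.
          by rewrite sum_nat_const card_ord muln1; lia.
        by apply: leq_sum => a _; rewrite lt0n.
      by exists a.
    rewrite /get /used /= off0 cap1 !v // s_n1 s_q in stuck.
    case: stuck => [wq0 | r0]; first by rewrite wq0 in wq.
    apply: (levelled_pos lev a_n ma).
      rewrite (listing_total lst') (bigD1 (Ordinal b_n)) //= (bigD1 (Ordinal c_n)) //=.
      by rewrite -/q; lia.
    by move=> i i_n mi; apply: r0 => //; rewrite add0n mi.
  have ext : listed n1 n2 n3 d1 w0 q q.+1 s'' es'.
    by split; [apply: partial_listing_ext lst' => // i; apply: same | rewrite pr''].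
  exists es'; split=> //=.
  - by move=> a a_n; rewrite /updm /= same // marks.
  - by under eq_bigr do rewrite /updm /= same //; rewrite /updm /= same.
  - case: lev => l lreg llev; exists l; first by move=> a a_n; rewrite /updm /= same //; apply: lreg.
    by case: llev => llev; [left | right] => a a_n; rewrite /updm /= !same //; apply: llev.
  - by rewrite /updm /= same // wq0.
rewrite /get /used /= off0 cap1 !v // s_n1 s_q.
move=> i_n wq mi ri rmax w'E r'E m'E pr''.
rewrite s_b s_c in pr''; rewrite add0n in mi; have mi0 : mem s' 5 i = 0 by lia.
have i_es : (i, b, c) \notin es' by have := marks i i_n; rewrite mi0; case: (_ \in _).
exists (rcons es' (i, b, c)); split=> /=.
- split; first exact: partial_listing_transfer lst' b_n c_n i_n wq ri i_es r'E w'E.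
  by rewrite /= pr'' pr' /edge_nats map_rcons flatten_rcons.
- move=> a a_n; rewrite /updm /= m'E marks // mem_rcons inE !xpair_eqE !eqxx !andbT add0n.
  by case: (a =P i) => [-> | _]; rewrite ?addn0 // (negPf i_es).
- rewrite /updm /= w'E eqxx.
  have -> : \sum_(a < n1) mem s'' 5 a = \sum_(a < n1) (mem s' 5 a + (true && (a == i :> nat))).
    by apply: eq_bigr => a _; rewrite m'E.
  by rewrite big_split sum_delta //= -addnA subnKC.
- apply: levelled_transfer lev i_n ri mi0 _ r'E _ => [a a_n ma|a].
    by apply: rmax; rewrite ?add0n ?ma.
  by rewrite /updm /= m'E.
- by rewrite /updm /= w'E eqxx; lia.
Qed.

Lemma list_edges_spec n1 n2 n3 d1 w0 s : sizes n1 n2 n3 s ->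
  mem s 1 =1 d1 -> mem s 4 =1 w0 -> printed s = [:: 1] ->
  (exists k, almost_regular n1 d1 k) ->
  (forall i j, i < n2 -> j < n3 -> w0 (i * n3 + j) <= n1) ->
  \sum_(a < n1) d1 a = \sum_(i < n2) \sum_(j < n3) w0 (i * n3 + j) ->
  exists es, listed n1 n2 n3 d1 w0 (n2 * n3) (n2 * n3) (eval list_edges s) es.
Proof.
move=> [s_n1 s_n2 s_n3 [s0 s1]] s_d1 s_w0 pr [k reg] le_w0 total.
set pair_loop := CFor xc xn3 (list_pair ;; CAdd xpair xpair xone).
set s2 := setv s xpair 0.
rewrite -[eval list_edges s]/(eval (CFor xb xn2 pair_loop) s2).
pose inv q s' := var s' xpair = q /\
  exists2 es, listed n1 n2 n3 d1 w0 q q s' es &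
    exists k, almost_regular n1 (mem s' 1) k.
suff: inv (var s2 xn2 * n3) (eval (CFor xb xn2 pair_loop) s2).
  by rewrite [var s2 xn2]s_n2 => -[_ [es lst _]]; exists es.
apply: (@eval_For (fun b => inv (b * n3))) => //.
  split=> //; exists [::].
    split; last by rewrite /= pr.
    split=> //=.
    - by move=> a _; rewrite addn0; apply: s_d1.
    - by move=> i j _ _; rewrite addn0; apply: s_w0.
    - rewrite -[RHS]/(\sum_(i < n2) \sum_(j < n3) mem s 4 (i * n3 + j)).
      rewrite (eq_bigr (fun a : 'I_n1 => d1 a)) ?total => [|a _]; last exact: s_d1.
      by apply: eq_bigr => i _; apply: eq_bigr => j _; rewrite s_w0.
  by exists k => a a_n; have := reg a a_n; rewrite /= /updm /= s_d1.
move=> b s' b_n s'b fr inv_s'.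
have v x : x \in [:: xn1; xn2; xn3; xzero; xone] -> var s' x = var s x.
  by rewrite !inE => /or4P[|||/orP[]] /eqP ->; rewrite fr.
rewrite [var s2 xn2]s_n2 in b_n.
have s'n3 : var s' xn3 = n3 by rewrite v.
have: inv (b * n3 + var s' xn3) (eval pair_loop s').
  apply: (@eval_For (fun c => inv (b * n3 + c))) => //; first by rewrite addn0.
  move=> c s'' c_n s''c fr' [s''q [es lst reg'']].
  have v'' x : x \in [:: xn1; xn2; xn3; xzero; xone] -> var s'' x = var s x.
    by move=> xP; rewrite -v //; move: xP; rewrite !inE => /or4P[|||/orP[]] /eqP ->; rewrite fr'.
  have sz : sizes n1 n2 n3 s'' by split; rewrite ?v'' //; split; rewrite v''.
  have s''b : var s'' xb = b by rewrite fr'.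
  rewrite s'n3 in c_n.
  have := list_pair_spec sz b_n c_n s''b s''c s''q (le_w0 _ _ b_n c_n) lst reg''.
  have := eval_frame s'' (isT : wf list_pair).
  rewrite -[eval (list_pair;; _) s'']/(let s3 := eval list_pair s'' in
    setv s3 xpair (var s3 xpair + var s3 xone)).
  move: (eval list_pair s'') => s3 fr3 [es3 lst3 reg3].
  rewrite addnS; split; last by exists es3.
  by rewrite /= /updm /= !fr3 // s''q v'' // s1 addn1.
by rewrite s'n3 -mulSnr.
Qed.

(** * Hypergraphs *)

Lemma card_set_sum (T : finType) (H : {set T}) (P : pred T) :
  #|[set e in H | P e]| = \sum_(e in H) P e.
Proof.
by rewrite -sum1dep_card big_mkcondr; apply: eq_bigr => e _; case: (P e).
Qed.

(** Double counting: the matrix records the number of hyperedges through each pair of vertices of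
    the second and third class, and the first two degree sums both count all hyperedges. *)
Lemma realization_feasible D (H : hypergraph_on D) : realization H ->
  feasible (size (deg1 D)) (size (deg2 D)) (size (deg3 D))
    (nth 0 (deg2 D)) (nth 0 (deg3 D)) (fun _ _ => 0) /\
  \sum_(a < size (deg1 D)) nth 0 (deg1 D) a =
  \sum_(b < size (deg2 D)) nth 0 (deg2 D) b.
Proof.
case/and3P=> /forallP deg1H /forallP deg2H /forallP deg3H; split; last first.
  have -> : \sum_(a < size (deg1 D)) nth 0 (deg1 D) a = #|H|.
    rewrite (eq_bigr (fun a => \sum_(e in H) (e.1.1 == a))) => [|a _]; last first.
      by rewrite -(eqP (deg1H a)) /degree1 card_set_sum.
    rewrite exchange_big -sum1_card; apply: eq_bigr => e _.
    rewrite -[RHS](@sum_delta _ (e.1.1 : nat) true (ltn_ord _)).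
    by apply: eq_bigr => a _; rewrite eq_sym.
  rewrite (eq_bigr (fun b => \sum_(e in H) (e.1.2 == b))) => [|b _]; last first.
    by rewrite -(eqP (deg2H b)) /degree2 card_set_sum.
  rewrite exchange_big -sum1_card; apply: eq_bigr => e _.
  rewrite -[LHS](@sum_delta _ (e.1.2 : nat) true (ltn_ord _)).
  by apply: eq_bigr => b _; rewrite eq_sym.
exists (fun i j => \sum_(e in H) ((e.1.2 == i :> nat) && (e.2 == j :> nat))).
split=> [i i_n|j j_n|i j _ _].
- rewrite -[i]/(nat_of_ord (Ordinal i_n)) -(eqP (deg2H _)) /degree2 card_set_sum.
  rewrite exchange_big; apply: eq_bigr => e _.
  rewrite -[RHS](sum_delta _ (ltn_ord e.2)).
  by apply: eq_bigr => c _; rewrite [_ == nat_of_ord e.2]eq_sym.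
- rewrite -[j]/(nat_of_ord (Ordinal j_n)) -(eqP (deg3H _)) /degree3 card_set_sum.
  rewrite exchange_big; apply: eq_bigr => e _.
  rewrite -[RHS](sum_delta _ (ltn_ord e.1.2)).
  by apply: eq_bigr => c _; rewrite [_ == nat_of_ord e.1.2]eq_sym andbC.
rewrite addn0 -(card_set_sum H (fun e => (e.1.2 == i :> nat) && (e.2 == j :> nat))).
(* Hyperedges through a fixed pair are determined by their vertex in the first class, so there are
   at most [n1] of them. *)
rewrite -(@card_in_imset _ _ (fun e => e.1.1)).
  by rewrite -[X in _ <= X]card_ord max_card.
move=> [[a b] c] [[a' b'] c'] /=; rewrite !inE /=.
move=> /and3P[_ /eqP bi /eqP cj] /and3P[_ /eqP b'i /eqP c'j] ->.
by congr (_, _, _); apply/val_inj; rewrite /= ?bi ?cj.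
Qed.

Lemma count_partition (T : eqType) (P : pred T) (f : T -> nat) n s :
  (forall x, x \in s -> f x < n) ->
  \sum_(j < n) count (fun x => P x && (f x == j)) s = count P s.
Proof.
elim: s => [|x s IH] fP /=; first by rewrite big1.
rewrite big_split /= IH => [|y ys]; last by rewrite fP // inE ys orbT.
congr (_ + _); rewrite -[RHS](sum_delta _ (fP x (mem_head _ _))).
by apply: eq_bigr => j _; rewrite [_ == f x]eq_sym.
Qed.

Lemma card_set_count (T : finType) (s : seq T) (P : pred T) : uniq s ->
  #|[set e in [set x in s] | P e]| = count P s.
Proof.
move=> s_uniq; rewrite -size_filter -(card_uniqP (filter_uniq P s_uniq)).
by apply: eq_card => e; rewrite !inE mem_filter andbC.
Qed.

Definition edge_val n1 n2 n3 (e : 'I_n1 * 'I_n2 * 'I_n3) : edge :=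
  (val e.1.1, val e.1.2, val e.2).

Lemma edges_of_ord n1 n2 n3 (es : seq edge) :
  (forall e, e \in es -> [/\ e.1.1 < n1, e.1.2 < n2 & e.2 < n3]) ->
  exists es' : seq ('I_n1 * 'I_n2 * 'I_n3), es = map (@edge_val n1 n2 n3) es'.
Proof.
elim: es => [|[[a b] c] es IH] es_range; first by exists [::].
have [/= a_n b_n c_n] := es_range _ (mem_head _ _).
have [e ees|es' ->] := IH; first by apply: es_range; rewrite inE ees orbT.
by exists ((Ordinal a_n, Ordinal b_n, Ordinal c_n) :: es').
Qed.

(** Once the matrix is used up, the counts of pairs equal its entries; summed along rows and columns
    they give the degrees in the second and third class. *)
Lemma listing_realization D lo w w0 r es :
  let n1 := size (deg1 D) in let n2 := size (deg2 D) in
  let n3 := size (deg3 D) in lo = n2 * n3 ->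
  partial_listing n1 n2 n3 (nth 0 (deg1 D)) w0 lo lo r w es ->
  (forall i, i < n2 -> \sum_(j < n3) w0 (i * n3 + j) = nth 0 (deg2 D) i) ->
  (forall j, j < n3 -> \sum_(i < n2) w0 (i * n3 + j) = nth 0 (deg3 D) j) ->
  exists es' : seq ('I_n1 * 'I_n2 * 'I_n3),
    [/\ uniq es', realization (D := D) [set e in es'] &
        edge_nats es = flatten [seq [:: val e.1.1; val e.1.2; val e.2] | e <- es']].
Proof.
move=> n1 n2 n3 loE [es_uniq es_range es_deg1 es_pair _ es_done total] rows cols.
have w_0 i j : i < n2 -> j < n3 -> w (i * n3 + j) = 0.
  by move=> i_n j_n; apply: es_done; rewrite loE; nia.
(* The totals agree throughout, so an exhausted matrix leaves no first degree either. *)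
have r_0 a : a < n1 -> r a = 0.
  move=> a_n; apply/eqP; rewrite -leqn0.
  have <- : \sum_(a < n1) r a = 0.
    by rewrite total big1 // => i _; rewrite big1 // => j _; apply: w_0.
  by rewrite (bigD1 (Ordinal a_n)) //= leq_addr.
have [es' esE] := edges_of_ord es_range.
have es'_uniq : uniq es' by apply: (@map_uniq _ _ (@edge_val n1 n2 n3)); rewrite -esE.
exists es'; split=> //; last by rewrite esE /edge_nats -map_comp.
apply/and3P; split; apply/forallP => v; apply/eqP.
- rewrite /degree1 card_set_count // -es_deg1 ?r_0 ?ltn_ord //.
  by rewrite esE count_map.
- rewrite /degree2 card_set_count // -rows //.
  under eq_bigr => j _ do rewrite -es_pair ?w_0 ?ltn_ord //.
  rewrite (@count_partition _ (fun e => e.1.2 == v :> nat) (fun e : edge => e.2)).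
    by rewrite esE count_map.
  by move=> e /es_range[].
- rewrite /degree3 card_set_count // -cols //.
  under eq_bigr => i _ do rewrite -es_pair ?w_0 ?ltn_ord //.
  rewrite (eq_bigr (fun i : 'I_n2 => count (fun e => (e.2 == v :> nat) && (e.1.2 == i :> nat)) es)); last first.
    by move=> i _; apply: eq_count => e; rewrite andbC.
  rewrite (@count_partition _ (fun e => e.2 == v :> nat) (fun e : edge => e.1.2)).
    by rewrite esE count_map.
  by move=> e /es_range[].
Qed.

(** * The whole algorithm *)

Definition read_array a y := CFor xk y (CRead xt ;; CSave a xk xt).
Definition add_array a y x := CFor xk y (CLoad xt a xk ;; CAdd x x xt).

Definition setup :=
  CSet xone 1 ;;
  read_array 1 xn1 ;; read_array 2 xn2 ;; read_array 3 xn3 ;;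
  add_array 1 xn1 xsum1 ;; add_array 2 xn2 xsum2.

(** The flag collects all leftover row and column degrees and, as the sum of two truncated
    differences, the distance between the first two degree sums; it is 0 only if all of these
    vanish. *)
Definition decide :=
  add_array 2 xn2 xflag ;; add_array 3 xn3 xflag ;;
  CSub xt xsum1 xsum2 ;; CAdd xflag xflag xt ;;
  CSub xt xsum2 xsum1 ;; CAdd xflag xflag xt.

Definition algorithm :=
  setup ;; fill_matrix ;; decide ;;
  CIf xflag (CPrint xzero) (CPrint xone ;; list_edges).

(** The row starts as zero, so the agreement with [nth 0] extends beyond the length of [xs]. *)
Lemma read_array_spec a y s xs ys : 0 < a < 7 -> y <= 2 ->
  mem s a =1 (fun=> 0) -> unread s = xs ++ ys -> size xs = var s y ->
  let s' := eval (read_array a y) s in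
  unread s' = ys /\ mem s' a =1 nth 0 xs.
Proof.
case: a => // a a7 y2 s_a s_xs sz.
pose I n s' := unread s' = drop n xs ++ ys /\
  forall i, mem s' a.+1 i = if i < n then nth 0 xs i else 0.
have: I (var s y) (eval (read_array a.+1 y) s).
  apply: eval_For; first by rewrite /= y2 a7.
    by split=> [|i]; rewrite ?drop0 //= /updm /= s_a.
  move=> n s' n_y s'n _ [s'_un s'_a].
  rewrite -sz in n_y; rewrite (drop_nth 0 n_y) in s'_un.
  split=> [|i] /=; first by rewrite s'_un.
  rewrite /updm /= s'_un s'n eqxx s'_a ltnS [i <= n]leq_eqVlt.
  by case: eqP => [-> | _].
rewrite /I -sz drop_size => -[-> s'_a]; split=> // i.
by rewrite s'_a; case: ltnP => // /(nth_default 0) ->.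
Qed.

Lemma add_array_spec a y x s : 0 < a < 7 -> y <= 2 -> xe < x ->
  var (eval (add_array a y x) s) x = var s x + \sum_(i < var s y) mem s a i.
Proof.
case: a => // a a7 y2 x_gt.
have xt' : (x == xt) = false by lia.
have xk' : (x == xk) = false by lia.
apply: (@eval_For (fun n s' => var s' x = var s x + \sum_(i < n) mem s a.+1 i)).
- by apply/and4P; split=> //=; rewrite ?inE; lia.
- by rewrite big_ord0 addn0 /= /updm /= xk'.
move=> n s' _ s'n fr s'x; rewrite big_ord_recr addnA -s'x /= /updm /= eqxx xk' xt' s'n.
by rewrite (fr a.+1).
Qed.

Lemma setup_spec d1 d2 d3 :
  let n1 := size d1 in let n2 := size d2 in let n3 := size d3 in
  let s := eval setup (Config (init_mem n1 n2 n3) (d1 ++ d2 ++ d3) [::]) in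
  sizes n1 n2 n3 s /\
  [/\ mem s 1 =1 nth 0 d1, mem s 2 =1 nth 0 d2, mem s 3 =1 nth 0 d3
    & mem s 4 =1 (fun=> 0)] /\
  [/\ var s xsum1 = \sum_(i < n1) nth 0 d1 i,
      var s xsum2 = \sum_(i < n2) nth 0 d2 i, var s xflag = 0 & printed s = [::]].
Proof.
move=> n1 n2 n3; set s0 := Config _ _ _.
have fr0 : frame setup s0 (eval setup s0) by apply: eval_frame.
have pr : printed (eval setup s0) = [::] by rewrite eval_printed.
pose s1 := setv s0 xone 1.
pose s2 := eval (read_array 1 xn1) s1.
pose s3 := eval (read_array 2 xn2) s2.
pose s4 := eval (read_array 3 xn3) s3.
pose s5 := eval (add_array 1 xn1 xsum1) s4.
pose s6 := eval (add_array 2 xn2 xsum2) s5.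
have s6E : eval setup s0 = s6 by [].
have fr2 : frame (read_array 1 xn1) s1 s2 by apply: eval_frame.
have fr3 : frame (read_array 2 xn2) s2 s3 by apply: eval_frame.
have fr4 : frame (read_array 3 xn3) s3 s4 by apply: eval_frame.
have fr5 : frame (add_array 1 xn1 xsum1) s4 s5 by apply: eval_frame.
have fr6 : frame (add_array 2 xn2 xsum2) s5 s6 by apply: eval_frame.
have [s2_un s2_1] : unread s2 = d2 ++ d3 /\ mem s2 1 =1 nth 0 d1.
  exact: read_array_spec.
have [s3_un s3_2] : unread s3 = d3 ++ [::] /\ mem s3 2 =1 nth 0 d2.
  apply: read_array_spec => //; first by move=> i; rewrite fr2.
    by rewrite cats0.
  by rewrite fr2.
have [_ s4_3] : unread s4 = [::] /\ mem s4 3 =1 nth 0 d3.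
  apply: read_array_spec s3_un _ => //; first by move=> i; rewrite fr3 ?fr2.
  by rewrite fr3 ?fr2.
have s4_1 : mem s4 1 =1 nth 0 d1 by move=> i; rewrite fr4 // fr3.
have s4_2 : mem s4 2 =1 nth 0 d2 by move=> i; rewrite fr4.
have s5_sum : var s5 xsum1 = \sum_(i < n1) nth 0 d1 i.
  rewrite add_array_spec // fr4 // fr3 // fr2 //= add0n.
  have -> : var s4 xn1 = n1 by rewrite fr4 // fr3 // fr2.
  by apply: eq_bigr => i _; rewrite s4_1.
have s6_sum : var s6 xsum2 = \sum_(i < n2) nth 0 d2 i.
  rewrite add_array_spec // fr5 // fr4 // fr3 // fr2 //= add0n.
  have -> : var s5 xn2 = n2 by rewrite fr5 // fr4 // fr3 // fr2.
  by apply: eq_bigr => i _; rewrite fr5 ?s4_2.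
split; last split.
- split; [by rewrite fr0 | by rewrite fr0 | by rewrite fr0 |].
  by split; [rewrite fr0 | rewrite s6E fr6 // fr5 // fr4 // fr3 // fr2].
- split=> i; first by rewrite s6E fr6 // fr5.
  + by rewrite s6E fr6 // fr5.
  + by rewrite s6E fr6 // fr5.
  + by rewrite fr0.
- by split; [rewrite s6E fr6 | rewrite s6E | rewrite fr0 | rewrite pr].
Qed.

Lemma decide_spec n1 n2 n3 s : sizes n1 n2 n3 s ->
  var (eval decide s) xflag = var s xflag + \sum_(i < n2) mem s 2 i
    + \sum_(j < n3) mem s 3 j + (var s xsum1 - var s xsum2)
    + (var s xsum2 - var s xsum1).
Proof.
move=> [s_n1 s_n2 s_n3 _].
set s1 := eval (add_array 2 xn2 xflag) s; set s2 := eval (add_array 3 xn3 xflag) s1.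
have fr1 : frame (add_array 2 xn2 xflag) s s1 by apply: eval_frame.
have fr2 : frame (add_array 3 xn3 xflag) s1 s2 by apply: eval_frame.
have s1E : var s1 xflag = var s xflag + \sum_(i < n2) mem s 2 i.
  by rewrite add_array_spec // s_n2.
have s2E : var s2 xflag = var s1 xflag + \sum_(j < n3) mem s 3 j.
  have s1_n3 : var s1 xn3 = n3 by rewrite fr1.
  rewrite add_array_spec // s1_n3; congr (_ + _).
  by apply: eq_bigr => j _; rewrite fr1.
rewrite -[eval decide s]/(eval (CSub xt xsum1 xsum2 ;; CAdd xflag xflag xt ;;
  CSub xt xsum2 xsum1 ;; CAdd xflag xflag xt) s2) -s1E -s2E.
have s2_1 : var s2 xsum1 = var s xsum1 by rewrite fr2 ?fr1.
have s2_2 : var s2 xsum2 = var s xsum2 by rewrite fr2 ?fr1.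
by rewrite /= /updm /= s2_1 s2_2.
Qed.

(** Without row demands the completion is zero, so nothing is missing in the columns. This prevents
    the rejection of a graphic sequence. *)
Lemma feasible_no_demand n1 n2 n3 D r W : feasible n1 n2 n3 D r W ->
  (forall i, i < n2 -> D i = 0) -> forall j, j < n3 -> r j = 0.
Proof.
move=> [x [xD xr _]] D0 j j_n; rewrite -xr // big1 // => i _.
have := xD _ (ltn_ord i); rewrite D0 // (bigD1 (Ordinal j_n)) //=; lia.
Qed.

(** A negative [k] is possible only for an empty first sequence, so the absolute value serves in all
    cases. *)
Lemma third_almost_regular_nat D : third_almost_regular D ->
  exists k, almost_regular (size (deg1 D)) (nth 0 (deg1 D)) k.
Proof.
move=> [k reg]; exists `|k|%N => a a_n.
have := reg _ (mem_nth 0 a_n); move: (nth 0 (deg1 D) a) => d.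
by case=> dk; [left | right]; lia.
Qed.

Lemma algorithm_correct D : third_almost_regular D ->
  correct_answer D (printed (eval algorithm
    (Config (init_mem (size (deg1 D)) (size (deg2 D)) (size (deg3 D)))
       (deg1 D ++ deg2 D ++ deg3 D) [::]))).
Proof.
move=> /third_almost_regular_nat reg.
set n1 := size (deg1 D); set n2 := size (deg2 D); set n3 := size (deg3 D).
have := setup_spec (deg1 D) (deg2 D) (deg3 D); cbv zeta.
rewrite -/n1 -/n2 -/n3; set s0 := Config _ _ _.
rewrite /algorithm (eval_seq setup) (eval_seq fill_matrix) (eval_seq decide).
move: (eval setup s0) => s1 [sz1 [[s1_1 s1_2 s1_3 s1_4] [s1_s1 s1_s2 s1_f s1_pr]]].
have := fill_matrix_spec sz1 s1_2 s1_3 s1_4; cbv zeta.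
have fr2 := eval_frame s1 (isT : wf fill_matrix).
have := eval_printed s1 (isT : ~~ prints fill_matrix).
move: (eval fill_matrix s1) fr2 => s2 fr2; rewrite s1_pr => s2_pr.
have sz2 : sizes n1 n2 n3 s2.
  by case: sz1 => ? ? ? [? ?]; split; [rewrite fr2 | rewrite fr2 | rewrite fr2 | split; rewrite fr2].
have := decide_spec sz2.
have fr3 := eval_frame s2 (isT : wf decide).
have := eval_printed s2 (isT : ~~ prints decide).
move: (eval decide s2) fr3 => s3 fr3; rewrite s2_pr => s3_pr.
rewrite [var s2 xflag]fr2 // s1_f add0n [var s2 xsum1]fr2 // [var s2 xsum2]fr2 // s1_s1 s1_s2.
move=> s3_f pm.
have sz3 : sizes n1 n2 n3 s3.
  by case: sz2 => ? ? ? [? ?]; split; [rewrite fr3 | rewrite fr3 | rewrite fr3 | split; rewrite fr3].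
rewrite /correct_answer eval_if; case: (posnP (var s3 xflag)) => [f0 | f_gt0]; last first.
  (* A realization makes the matrix problem feasible, so the first phase would have met all demands
     and the flag would be 0. *)
  have /negPf -> : ~~ graphic D.
    apply: contraTN f_gt0 => /existsP[H /realization_feasible[fsb tot]].
    have [fsb' D0] := completable pm fsb.
    rewrite s3_f tot subnn !addn0 big1 => [|i _]; last exact: D0.
    by rewrite add0n big1 // => j _; apply: feasible_no_demand fsb' D0 _ _.
  by rewrite /= s3_pr; case: sz3 => _ _ _ [-> _].
rewrite f0 in s3_f.
have D0 i : i < n2 -> mem s2 2 i = 0.
  by move=> i_n; move: s3_f; rewrite (bigD1 (Ordinal i_n)) //=; lia.
have r0 j : j < n3 -> mem s2 3 j = 0.
  by move=> j_n; move: s3_f; rewrite [X in _ + X + _ + _](bigD1 (Ordinal j_n)) //=; lia.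
have tot : \sum_(i < n1) nth 0 (deg1 D) i = \sum_(i < n2) nth 0 (deg2 D) i by lia.
have rows i : i < n2 -> \sum_(j < n3) mem s2 4 (i * n3 + j) = nth 0 (deg2 D) i.
  by move=> i_n; rewrite -(row_sum pm i_n) D0.
have cols j : j < n3 -> \sum_(i < n2) mem s2 4 (i * n3 + j) = nth 0 (deg3 D) j.
  by move=> j_n; rewrite -(col_sum pm j_n) r0.
rewrite eval_seq; set s4 := eval (CPrint xone) s3.
have [es [lst pr]] : exists es, listed n1 n2 n3 (nth 0 (deg1 D)) (mem s2 4)
    (n2 * n3) (n2 * n3) (eval list_edges s4) es.
  apply: list_edges_spec => //.
  - by move=> i; rewrite /= fr3 // fr2.
  - by move=> i; rewrite /= fr3.
  - by rewrite /= s3_pr; case: sz3 => _ _ _ [_ ->].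
  - exact: entry_le pm.
  - by rewrite tot; apply: eq_bigr => i _; rewrite rows.
have [es' [es'_uniq real es'E]] := listing_realization erefl lst rows cols.
have -> : graphic D by apply/existsP; exists [set e in es'].
by exists es'; split=> //; rewrite -es'E.
Qed.

Theorem theorem11 :
  exists (P : program) (p : {poly nat}),
    forall D : degree_sequence, third_almost_regular D ->
      exists (t : nat) (y : seq nat),
        [/\ computes_in_time P (encode D) t y,
            correct_answer D y
          & (t <= (p.[bitsize (encode D)])%R)%N].
Proof.
have [P [p runP]] := program_of_cmd (isT : wf algorithm).
exists P, p => D reg.
(* Every number has at least one bit. As the degrees are listed one by one, this bounds the class
   sizes by the input size, although they are themselves encoded in binary. *)
have size_le (x : seq nat) : size x <= bitsize x.
  by elim: x => [|n x IH] //=; rewrite /bitsize big_cons -add1n leq_add.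
have n_le : size (deg1 D) + size (deg2 D) + size (deg3 D) <= bitsize (encode D).
  by apply: leq_trans (size_le _); rewrite /= !size_cat; lia.
have [t run_t t_le] := runP _ _ _ _ n_le.
by exists t; eexists; split; [exact: run_t | exact: algorithm_correct |].
Qed.
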